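(* The calculus D.LRC is complete: every axiom of the Hilbert system H.LRC is derivable in D.LRC (for a resource-entailment axiom $\alpha\vdash\beta$ the sequent $\alpha\vdash\beta$ is derivable, and for a formula axiom $C$ the sequent $\mathrm{I}\vdash C$ is derivable), and every rule of H.LRC is a derivable rule of D.LRC. Consequently D.LRC is complete with respect to perfect heterogeneous LRC-algebras: for all LRC-formulas $A,B$, if the value of $A$ is $\le$ the value of $B$ in every algebraic LRC-model based on a perfect heterogeneous LRC-algebra, then the sequent $A\vdash B$ is derivable in D.LRC.
   Context: LANGUAGE. Fix countable disjoint sets $\mathsf{AtProp}$ and $\mathsf{AtRes}$. Resource terms: $\alpha::=a\in\mathsf{AtRes}\mid 1\mid 0\mid\alpha\cdot\alpha\mid\alpha\sqcup\alpha\mid\alpha\sqcap\alpha$. LRC-formulas: $A::=p\in\mathsf{AtProp}\mid\top\mid\bot\mid A\vee A\mid A\wedge A\mid A\to A\mid\alpha\vartriangleright A\mid\Diamond A\mid\Diamond_r\alpha\mid\alpha\vartriangleright_r\alpha$. $\Diamond,\Diamond_r,\vartriangleright,\vartriangleright_r$ bind more strongly than $\wedge,\vee$, which bind more strongly than $\to$. HILBERT SYSTEM H.LRC. Resource entailment $\alpha\vdash\beta$ is the least preorder on resource terms such that: (R1) $\sqcup$ and $\sqcap$ are join and meet and distribute over each other; (R2) $\cdot$ is associative with unit $1$ (up to mutual entailment); (R3) $\alpha\vdash1$ and $0\vdash\alpha$; (R4) $\alpha\cdot(\beta\sqcup\gamma)\vdash(\alpha\cdot\beta)\sqcup(\alpha\cdot\gamma)$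 and $(\beta\sqcup\gamma)\cdot\alpha\vdash(\beta\cdot\alpha)\sqcup(\gamma\cdot\alpha)$; (MF, MF') if $\alpha\vdash\beta$ then $\alpha\cdot\gamma\vdash\beta\cdot\gamma$ and $\gamma\cdot\alpha\vdash\gamma\cdot\beta$. The set of LRC-theorems is the least set of formulas containing the axioms of intuitionistic propositional logic and all instances of: (D1) $\Diamond(A\vee B)\leftrightarrow\Diamond A\vee\Diamond B$; (D2) $\Diamond\bot\leftrightarrow\bot$; (D3) $\Diamond_r(\alpha\sqcup\beta)\leftrightarrow\Diamond_r\alpha\vee\Diamond_r\beta$; (D4) $\Diamond_r0\leftrightarrow\bot$; (B1) $(\alpha\sqcup\beta)\vartriangleright A\leftrightarrow\alpha\vartriangleright A\wedge\beta\vartriangleright A$; (B2) $0\vartriangleright A$; (B3) $\alpha\vartriangleright(\beta\vartriangleright A)\to(\alpha\cdot\beta)\vartriangleright A$; (B4) $(\alpha\sqcup\beta)\vartriangleright_r\gamma\leftrightarrow\alpha\vartriangleright_r\gamma\wedge\beta\vartriangleright_r\gamma$; (B5) $0\vartriangleright_r\alpha$; (B6) $\alpha\vartriangleright_r(\beta\sqcap\gamma)\leftrightarrow\alpha\vartriangleright_r\beta\wedge\alpha\vartriangleright_r\gamma$; (B7) $\alpha\vartriangleright_r1$; (BD1) $\Diamond_r\alpha\wedge\alpha\vartriangleright A\to\Diamond A$; (BD2) $\alpha\vartriangleright_r\beta\to\alpha\vartriangleright\Diamond_r\beta$; closed under modus ponens, uniform substitution and the rules (written with $A\vdash B$ for theoremhood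 of $A\to B$; in D.LRC they are read as rules on sequents): from $A\vdash B$ infer $\alpha\vartriangleright A\vdash\alpha\vartriangleright B$ (MB) and $\Diamond A\vdash\Diamond B$ (MD); from $\alpha\vdash\beta$ infer $\beta\vartriangleright A\vdash\alpha\vartriangleright A$ (AB), $\Diamond_r\alpha\vdash\Diamond_r\beta$ (MD'), $\gamma\vartriangleright_r\alpha\vdash\gamma\vartriangleright_r\beta$ (MB'), $\beta\vartriangleright_r\gamma\vdash\alpha\vartriangleright_r\gamma$ (AB'). ALGEBRAS. A heterogeneous LRC-algebra is $F=(\mathbb{A},\mathbb{Q},\vartriangleright,\Diamond,\vartriangleright_r,\Diamond_r)$ where $\mathbb{A}$ is a Heyting algebra, $\mathbb{Q}=(Q,\sqcup,\sqcap,\cdot,0,1)$ is a bounded distributive lattice with an associative binary operation $\cdot$ preserving finite joins in each coordinate and having the lattice top $1$ as two-sided unit, and $\vartriangleright:\mathbb{Q}\times\mathbb{A}\to\mathbb{A}$, $\Diamond:\mathbb{A}\to\mathbb{A}$, $\vartriangleright_r:\mathbb{Q}\times\mathbb{Q}\to\mathbb{A}$, $\Diamond_r:\mathbb{Q}\to\mathbb{A}$ satisfy: $\Diamond$ and $\Diamond_r$ preserve finite joins (including the empty one); $\vartriangleright$ is monotone in the second coordinate, and $(\alpha\sqcup\beta)\vartriangleright u=\alpha\vartriangleright u\wedge\beta\vartriangleright u$, $0\vartriangleright u=\top$; $\vartriangleright_r$ turns finite joins in the first coordinate into meets and preserves finite meets in the second coordinate (including empty ones); $\alpha\vartriangleright(\beta\vartriangleright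 u)\le(\alpha\cdot\beta)\vartriangleright u$; $\Diamond_r\alpha\wedge\alpha\vartriangleright u\le\Diamond u$; $\alpha\vartriangleright_r\beta\le\alpha\vartriangleright\Diamond_r\beta$. It is perfect if the lattice reducts of $\mathbb{A}$ and $\mathbb{Q}$ are complete, completely distributive and completely join-generated by their completely join-irreducible elements, $\cdot$ preserves arbitrary joins in each coordinate, $\Diamond,\Diamond_r$ preserve arbitrary joins, $\vartriangleright$ turns arbitrary joins in the first coordinate into meets, and $\vartriangleright_r$ turns arbitrary joins in the first coordinate into meets and preserves arbitrary meets in the second. An algebraic LRC-model is an algebra with maps $\mathsf{AtProp}\to\mathbb{A}$, $\mathsf{AtRes}\to\mathbb{Q}$, extended homomorphically to all terms. STRUCTURES OF D.LRC. Structures are of type Fm ($X,Y,Z,W$) or Res ($\Gamma,\Delta,\Sigma,\Pi$), and occur in antecedent ($a$) or succedent ($s$) position. With $A$ ranging over formulas and $\alpha$ over resource terms: $X_a::=A\mid\mathrm{I}\mid X_a;X_a\mid X_s>X_a\mid X_a<X_s\mid\circ X_a\mid\circ_r\Gamma_a$; $X_s::=A\mid\mathrm{I}\mid X_s;X_s\mid X_a>X_s\mid X_s<X_a\mid\bullet X_s\mid\Gamma_a\,\hat{\vartriangleright}\,X_s\mid\Gamma_a\,\hat{\vartriangleright}_r\,\Gamma_s$; $\Gamma_a::=\alpha\mid\Phi\mid\Gamma_a\odot\Gamma_a\mid\Gamma_a,\Gamma_a\mid\Gamma_s\sqsupset\Gamma_a\mid\Gamma_a\sqsubset\Gamma_s\mid\Gamma_a\,\hat{\blacktriangle}_r\,X_a$;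 $\Gamma_s::=\alpha\mid\Phi\mid\Gamma_s,\Gamma_s\mid\Gamma_a\gtrdot\Gamma_s\mid\Gamma_s\lessdot\Gamma_a\mid\Gamma_a\sqsupset\Gamma_s\mid\Gamma_s\sqsubset\Gamma_a\mid\bullet_rX_s\mid X_a\,\hat{\blacktriangleright}\,X_s\mid X_a\,\hat{\blacktriangleright}_r\,\Gamma_s$. Sequents: $X_a\vdash X_s$ or $\Gamma_a\vdash\Gamma_s$ (subscripts omitted below; each rule instance must consist of such well-positioned sequents). RULES OF D.LRC (''$S/T$'': from $S$ infer $T$; ''$S\,//\,T$'': both directions). Axioms: $p\vdash p$; $a\vdash a$ (atoms). Cut: $(X\vdash Y)[A]^{succ}$, $A\vdash Z\,/\,(X\vdash Y)[Z/A]^{succ}$ (replacing an occurrence of $A$ as a substructure in succedent position); $\Gamma\vdash\alpha$, $\alpha\vdash\Delta\,/\,\Gamma\vdash\Delta$. Display Fm: $X;Y\vdash Z//Y\vdash X>Z$; $Z\vdash X;Y//X>Z\vdash Y$; $X;Y\vdash Z//X\vdash Z<Y$; $Z\vdash X;Y//Z<Y\vdash X$. Display Res: $\Gamma,\Delta\vdash\Sigma//\Delta\vdash\Gamma\sqsupset\Sigma$; $\Gamma,\Delta\vdash\Sigma//\Gamma\vdash\Sigma\sqsubset\Delta$; $\Gamma\vdash\Delta,\Sigma//\Delta\sqsupset\Gamma\vdash\Sigma$; $\Gamma\vdash\Delta,\Sigma//\Gamma\sqsubset\Sigma\vdash\Delta$; $\Gamma\odot\Delta\vdash\Sigma//\Delta\vdash\Gamma\gtrdot\Sigma$;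 $\Gamma\odot\Delta\vdash\Sigma//\Gamma\vdash\Sigma\lessdot\Delta$. Display modal: $\circ X\vdash Y//X\vdash\bullet Y$; $\circ_r\Gamma\vdash X//\Gamma\vdash\bullet_rX$; $X\vdash\Gamma\hat{\vartriangleright}Y//\Gamma\vdash X\hat{\blacktriangleright}Y$; $X\vdash\Gamma\hat{\vartriangleright}_r\Delta//\Gamma\hat{\blacktriangle}_rX\vdash\Delta$; $X\vdash\Gamma\hat{\vartriangleright}_r\Delta//\Gamma\vdash X\hat{\blacktriangleright}_r\Delta$. Structural Fm: $X\vdash Y//\mathrm{I};X\vdash Y$; $Y\vdash X//Y\vdash X;\mathrm{I}$; $Y;X\vdash Z/X;Y\vdash Z$; $Z\vdash X;Y/Z\vdash Y;X$; $Y\vdash Z/X;Y\vdash Z$; $Z\vdash Y/Z\vdash Y;X$; $X;X\vdash Y/X\vdash Y$; $Y\vdash X;X/Y\vdash X$; $X;(Y;Z)\vdash W//(X;Y);Z\vdash W$; $W\vdash(Z;Y);X//W\vdash Z;(Y;X)$. Structural Res: $\Gamma\odot\Phi\vdash\Delta//\Gamma\vdash\Delta$; $\Gamma\vdash\Delta//\Phi\odot\Gamma\vdash\Delta$; $\Gamma\vdash\Delta//\Gamma\vdash\Delta,\Phi$; $\Gamma\odot(\Delta\odot\Sigma)\vdash\Pi//(\Gamma\odot\Delta)\odot\Sigma\vdash\Pi$; $\Phi\vdash\Delta/\Gamma\vdash\Delta$; $\Gamma\vdash\Delta/\Gamma,\Sigma\vdash\Delta$; $\Gamma\vdash\Delta/\Gamma\vdash\Delta,\Sigma$;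 $\Gamma,\Gamma\vdash\Delta/\Gamma\vdash\Delta$; $\Gamma\vdash\Delta,\Delta/\Gamma\vdash\Delta$; $\Gamma,\Delta\vdash\Sigma/\Delta,\Gamma\vdash\Sigma$; $\Sigma\vdash\Gamma,\Delta/\Sigma\vdash\Delta,\Gamma$; $\Sigma,(\Delta,\Gamma)\vdash\Pi//(\Sigma,\Delta),\Gamma\vdash\Pi$; $\Pi\vdash\Sigma,(\Delta,\Gamma)//\Pi\vdash(\Sigma,\Delta),\Gamma$; $\Pi\vdash(\Gamma\gtrdot\Delta),(\Gamma\gtrdot\Sigma)/\Pi\vdash\Gamma\gtrdot(\Delta,\Sigma)$. D-rules: $X\vdash\bullet Y;\bullet Z/X\vdash\bullet(Y;Z)$; $\Gamma\vdash\bullet_rX,\bullet_rY/\Gamma\vdash\bullet_r(X;Y)$; $X\vdash\mathrm{I}/X\vdash\bullet\mathrm{I}$; $\Gamma\vdash\Phi/\Gamma\vdash\bullet_r\mathrm{I}$. B-rules: $\Gamma\vdash(Y\hat{\blacktriangleright}_r\Delta),(Z\hat{\blacktriangleright}_r\Delta)/\Gamma\vdash(Y;Z)\hat{\blacktriangleright}_r\Delta$; $\Gamma\vdash(Y\hat{\blacktriangleright}W),(Z\hat{\blacktriangleright}W)/\Gamma\vdash(Y;Z)\hat{\blacktriangleright}W$; $(\Gamma\hat{\blacktriangle}_rX),(\Gamma\hat{\blacktriangle}_rY)\vdash\Delta/\Gamma\hat{\blacktriangle}_r(X;Y)\vdash\Delta$; $X\vdash\Gamma\hat{\vartriangleright}(\Delta\hat{\vartriangleright}Y)/X\vdash(\Gamma\odot\Delta)\hat{\vartriangleright}Y$;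 $\Phi\vdash\Delta/\Gamma\hat{\blacktriangle}_r\mathrm{I}\vdash\Delta$. BD-rules: $X\vdash\Gamma\hat{\vartriangleright}\bullet Y/X\vdash\circ_r\Gamma>Y$; $X\vdash\Gamma\hat{\vartriangleright}_r\bullet_rY/X\vdash\Gamma\hat{\vartriangleright}Y$. Logical Fm: $\bot\vdash\mathrm{I}$; $X\vdash\mathrm{I}/X\vdash\bot$; $\mathrm{I}\vdash X/\top\vdash X$; $\mathrm{I}\vdash\top$; $A;B\vdash X/A\wedge B\vdash X$; $X\vdash A,\ Y\vdash B$ (two premises) $/X;Y\vdash A\wedge B$; $A\vdash X$ and $B\vdash Y/A\vee B\vdash X;Y$; $X\vdash A;B/X\vdash A\vee B$; $X\vdash A$ and $B\vdash Y/A\to B\vdash X>Y$; $X\vdash A>B/X\vdash A\to B$. Logical Res: $0\vdash\Phi$; $\Gamma\vdash\Phi/\Gamma\vdash0$; $\Phi\vdash\Gamma/1\vdash\Gamma$; $\Phi\vdash1$; $\alpha\odot\beta\vdash\Gamma/\alpha\cdot\beta\vdash\Gamma$; $\Gamma\vdash\alpha$ and $\Delta\vdash\beta/\Gamma\odot\Delta\vdash\alpha\cdot\beta$; $\alpha\vdash\Gamma$ and $\beta\vdash\Delta/\alpha\sqcup\beta\vdash(\Gamma,\Delta)$; $\Gamma\vdash(\alpha,\beta)/\Gamma\vdash\alpha\sqcup\beta$; $(\alpha,\beta)\vdash\Gamma/\alpha\sqcap\beta\vdash\Gamma$; $\Gamma\vdash\alpha$ and $\Delta\vdash\beta/(\Gamma,\Delta)\vdash\alpha\sqcap\beta$.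 Logical modal: $\circ A\vdash X/\Diamond A\vdash X$; $X\vdash A/\circ X\vdash\Diamond A$; $\Gamma\vdash\alpha$ and $A\vdash X/\alpha\vartriangleright A\vdash\Gamma\hat{\vartriangleright}X$; $X\vdash\alpha\hat{\vartriangleright}A/X\vdash\alpha\vartriangleright A$; $\circ_r\alpha\vdash X/\Diamond_r\alpha\vdash X$; $\Gamma\vdash\alpha/\circ_r\Gamma\vdash\Diamond_r\alpha$; $\Gamma\vdash\alpha$ and $\beta\vdash\Delta/\alpha\vartriangleright_r\beta\vdash\Gamma\hat{\vartriangleright}_r\Delta$; $X\vdash\alpha\hat{\vartriangleright}_r\beta/X\vdash\alpha\vartriangleright_r\beta$. Derivable rule for uniform substitution is understood as closure of derivability under uniform substitution; modus ponens as: from $\mathrm{I}\vdash A$ and $\mathrm{I}\vdash A\to B$ infer $\mathrm{I}\vdash B$. *)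

(* Defs.v *)
From mathcomp Require Import all_boot all_order.
From mathcomp Require Import classical_sets.

Set Implicit Arguments.
Unset Strict Implicit.
Unset Printing Implicit Defensive.

Local Open Scope classical_set_scope.
Local Open Scope order_scope.

Declare Scope lrc_scope.
Declare Scope fma_scope.
Declare Scope fms_scope.
Declare Scope resa_scope.
Declare Scope ress_scope.
Delimit Scope lrc_scope with lrc.
Delimit Scope fma_scope with fma.
Delimit Scope fms_scope with fms.
Delimit Scope resa_scope with resa.
Delimit Scope ress_scope with ress.

Section Language.
Context (AtProp AtRes : Type).

Inductive res : Type :=
| RAtom of AtRes
| ROne
| RZero
| RDot of res & res
| RJoin of res & res
| RMeet of res & res.

Inductive fm : Type :=
| FAtom of AtProp
| FTop
| FBot
| FOr of fm & fm
| FAnd of fm & fm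
| FImp of fm & fm
| FTri of res & fm
| FDia of fm
| FDiaR of res
| FTriR of res & res.

(* Structures are sorted by type (Fm or Res) and by position (antecedent or   *)
(* succedent), so that only well-positioned structures can be written.        *)
Inductive fma : Type :=
| AFm of fm
| AI
| ASemi of fma & fma
| AGt of fms & fma
| ALt of fma & fms
| ACirc of fma
| ACircR of resa
with fms : Type :=
| SFm of fm
| SI
| SSemi of fms & fms
| SGt of fma & fms
| SLt of fms & fma
| SBul of fms
| STri of resa & fms
| STriR of resa & ress
with resa : Type :=
| ARes of res
| APhi
| AOdot of resa & resa
| AComma of resa & resa
| ASqsup of ress & resa
| ASqsub of resa & ress
| ABTriUpR of resa & fma
with ress : Type :=
| SRes of res
| SPhi
| SComma of ress & ress
| SGtdot of resa & ress
| SLtdot of ress & resa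
| SSqsup of resa & ress
| SSqsub of ress & resa
| SBulR of fms
| SBTri of fma & fms
| SBTriR of fma & ress.

Inductive sequent : Type :=
| SeqFm of fma & fms
| SeqRes of resa & ress.

End Language.

Arguments ROne {AtRes}.
Arguments RZero {AtRes}.
Arguments RAtom {AtRes} a : rename.
Arguments FAtom {AtProp AtRes} p : rename.
Arguments FTop {AtProp AtRes}.
Arguments FBot {AtProp AtRes}.
Arguments FDiaR {AtProp AtRes} α : rename.
Arguments FTriR {AtProp AtRes} α β : rename.
Arguments AI {AtProp AtRes}.
Arguments SI {AtProp AtRes}.
Arguments APhi {AtProp AtRes}.
Arguments SPhi {AtProp AtRes}.
Arguments ARes {AtProp AtRes} α : rename.
Arguments SRes {AtProp AtRes} α : rename.
Arguments SeqFm {AtProp AtRes} X%_fma Y%_fms : rename.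
Arguments SeqRes {AtProp AtRes} Γ%_resa Δ%_ress : rename.

Coercion AFm : fm >-> fma.
Coercion SFm : fm >-> fms.
#[warning="-uniform-inheritance"]
Coercion ARes : res >-> resa.
#[warning="-uniform-inheritance"]
Coercion SRes : res >-> ress.

Notation "⊤" := FTop : lrc_scope.
Notation "⊥" := FBot : lrc_scope.
Notation "𝟙" := ROne : lrc_scope.
Notation "𝟘" := RZero : lrc_scope.
Notation "α · β" := (RDot α β) (at level 40, left associativity) : lrc_scope.
Notation "α ⊔ β" := (RJoin α β) (at level 50, left associativity) : lrc_scope.
Notation "α ⊓ β" := (RMeet α β) (at level 50, left associativity) : lrc_scope.
Notation "◇ A" := (FDia A) (at level 51, right associativity) : lrc_scope.
Notation "◇ᵣ α" := (FDiaR α) (at level 51, right associativity) : lrc_scope.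
Notation "α ▷ A" := (FTri α A) (at level 51, right associativity) : lrc_scope.
Notation "α ▷ᵣ β" := (FTriR α β) (at level 51, right associativity) : lrc_scope.
Notation "A ∧ B" := (FAnd A B) (at level 54, left associativity) : lrc_scope.
Notation "A ∨ B" := (FOr A B) (at level 54, left associativity) : lrc_scope.
Notation "A → B" := (FImp A B) (at level 56, right associativity) : lrc_scope.
Notation "A ↔ B" := (FAnd (FImp A B) (FImp B A))
  (at level 57, no associativity) : lrc_scope.

(* The structural connectives are overloaded as in display calculi: ";;" and   *)
(* ",," are the structural semicolon and comma, "𝕀" and "Φ" the structural     *)
(* constants, and a caret marks the hatted triangles.                          *)
Notation "'𝕀'" := AI : fma_scope.
Notation "X ;; Y" := (ASemi X%fma Y%fma)
  (at level 61, left associativity) : fma_scope.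
Notation "X > Y" := (AGt X%fms Y%fma) : fma_scope.
Notation "X < Y" := (ALt X%fma Y%fms) : fma_scope.
Notation "∘ X" := (ACirc X%fma) (at level 58, right associativity) : fma_scope.
Notation "∘ᵣ Γ" := (ACircR Γ%resa)
  (at level 58, right associativity) : fma_scope.

Notation "'𝕀'" := SI : fms_scope.
Notation "X ;; Y" := (SSemi X%fms Y%fms)
  (at level 61, left associativity) : fms_scope.
Notation "X > Y" := (SGt X%fma Y%fms) : fms_scope.
Notation "X < Y" := (SLt X%fms Y%fma) : fms_scope.
Notation "• X" := (SBul X%fms) (at level 58, right associativity) : fms_scope.
Notation "Γ ^▷ X" := (STri Γ%resa X%fms)
  (at level 65, no associativity) : fms_scope.
Notation "Γ ^▷ᵣ Δ" := (STriR Γ%resa Δ%ress)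
  (at level 65, no associativity) : fms_scope.

Notation "'Φ'" := APhi : resa_scope.
Notation "Γ ⊙ Δ" := (AOdot Γ%resa Δ%resa)
  (at level 61, left associativity) : resa_scope.
Notation "Γ ,, Δ" := (AComma Γ%resa Δ%resa)
  (at level 62, left associativity) : resa_scope.
Notation "Γ ⊐ Δ" := (ASqsup Γ%ress Δ%resa)
  (at level 65, no associativity) : resa_scope.
Notation "Γ ⊏ Δ" := (ASqsub Γ%resa Δ%ress)
  (at level 65, no associativity) : resa_scope.
Notation "Γ ^▲ᵣ X" := (ABTriUpR Γ%resa X%fma)
  (at level 65, no associativity) : resa_scope.

Notation "'Φ'" := SPhi : ress_scope.
Notation "Γ ,, Δ" := (SComma Γ%ress Δ%ress)
  (at level 62, left associativity) : ress_scope.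
Notation "Γ ⋗ Δ" := (SGtdot Γ%resa Δ%ress)
  (at level 65, no associativity) : ress_scope.
Notation "Γ ⋖ Δ" := (SLtdot Γ%ress Δ%resa)
  (at level 65, no associativity) : ress_scope.
Notation "Γ ⊐ Δ" := (SSqsup Γ%resa Δ%ress)
  (at level 65, no associativity) : ress_scope.
Notation "Γ ⊏ Δ" := (SSqsub Γ%ress Δ%resa)
  (at level 65, no associativity) : ress_scope.
Notation "•ᵣ X" := (SBulR X%fms) (at level 58, right associativity) : ress_scope.
Notation "X ^▶ Y" := (SBTri X%fma Y%fms)
  (at level 65, no associativity) : ress_scope.
Notation "X ^▶ᵣ Δ" := (SBTriR X%fma Δ%ress)
  (at level 65, no associativity) : ress_scope.

Notation "X ⊢ Y" := (SeqFm X%fma Y%fms)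
  (at level 80, no associativity) : lrc_scope.
Notation "Γ ⊢ᵣ Δ" := (SeqRes Γ%resa Δ%ress)
  (at level 80, no associativity) : lrc_scope.

Local Open Scope lrc_scope.

Section Substitution.
Context (AtProp AtRes : Type).
Context (σ : AtProp -> fm AtProp AtRes) (τ : AtRes -> res AtRes).

Fixpoint res_subst (α : res AtRes) : res AtRes :=
  match α with
  | RAtom a => τ a
  | ROne => 𝟙
  | RZero => 𝟘
  | RDot α β => res_subst α · res_subst β
  | RJoin α β => res_subst α ⊔ res_subst β
  | RMeet α β => res_subst α ⊓ res_subst β
  end.

Fixpoint fm_subst (A : fm AtProp AtRes) : fm AtProp AtRes :=
  match A with
  | FAtom p => σ p
  | FTop => ⊤
  | FBot => ⊥
  | FOr A B => fm_subst A ∨ fm_subst B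
  | FAnd A B => fm_subst A ∧ fm_subst B
  | FImp A B => fm_subst A → fm_subst B
  | FTri α A => res_subst α ▷ fm_subst A
  | FDia A => ◇ fm_subst A
  | FDiaR α => ◇ᵣ res_subst α
  | FTriR α β => res_subst α ▷ᵣ res_subst β
  end.

Fixpoint fma_subst (X : fma AtProp AtRes) : fma AtProp AtRes :=
  match X with
  | AFm A => fm_subst A
  | AI => AI
  | ASemi X Y => ASemi (fma_subst X) (fma_subst Y)
  | AGt X Y => AGt (fms_subst X) (fma_subst Y)
  | ALt X Y => ALt (fma_subst X) (fms_subst Y)
  | ACirc X => ACirc (fma_subst X)
  | ACircR Γ => ACircR (resa_subst Γ)
  end
with fms_subst (X : fms AtProp AtRes) : fms AtProp AtRes :=
  match X with
  | SFm A => fm_subst A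
  | SI => SI
  | SSemi X Y => SSemi (fms_subst X) (fms_subst Y)
  | SGt X Y => SGt (fma_subst X) (fms_subst Y)
  | SLt X Y => SLt (fms_subst X) (fma_subst Y)
  | SBul X => SBul (fms_subst X)
  | STri Γ X => STri (resa_subst Γ) (fms_subst X)
  | STriR Γ Δ => STriR (resa_subst Γ) (ress_subst Δ)
  end
with resa_subst (Γ : resa AtProp AtRes) : resa AtProp AtRes :=
  match Γ with
  | ARes α => res_subst α
  | APhi => APhi
  | AOdot Γ Δ => AOdot (resa_subst Γ) (resa_subst Δ)
  | AComma Γ Δ => AComma (resa_subst Γ) (resa_subst Δ)
  | ASqsup Γ Δ => ASqsup (ress_subst Γ) (resa_subst Δ)
  | ASqsub Γ Δ => ASqsub (resa_subst Γ) (ress_subst Δ)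
  | ABTriUpR Γ X => ABTriUpR (resa_subst Γ) (fma_subst X)
  end
with ress_subst (Γ : ress AtProp AtRes) : ress AtProp AtRes :=
  match Γ with
  | SRes α => res_subst α
  | SPhi => SPhi
  | SComma Γ Δ => SComma (ress_subst Γ) (ress_subst Δ)
  | SGtdot Γ Δ => SGtdot (resa_subst Γ) (ress_subst Δ)
  | SLtdot Γ Δ => SLtdot (ress_subst Γ) (resa_subst Δ)
  | SSqsup Γ Δ => SSqsup (resa_subst Γ) (ress_subst Δ)
  | SSqsub Γ Δ => SSqsub (ress_subst Γ) (resa_subst Δ)
  | SBulR X => SBulR (fms_subst X)
  | SBTri X Y => SBTri (fma_subst X) (fms_subst Y)
  | SBTriR X Δ => SBTriR (fma_subst X) (ress_subst Δ)
  end.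

Definition seq_subst (s : sequent AtProp AtRes) : sequent AtProp AtRes :=
  match s with
  | SeqFm X Y => fma_subst X ⊢ fms_subst Y
  | SeqRes Γ Δ => resa_subst Γ ⊢ᵣ ress_subst Δ
  end.

End Substitution.

Section Hilbert.
Context (AtProp AtRes : Type).
Implicit Types (A B C : fm AtProp AtRes) (α β γ : res AtRes).

(* Reflexivity, join and meet are given by their usual axioms here and by the  *)
(* rules [h_trans], [h_join] and [h_meet] below.                               *)
Inductive res_axiom : res AtRes -> res AtRes -> Prop :=
| ra_refl α : res_axiom α α
| ra_joinl α β : res_axiom α (α ⊔ β)
| ra_joinr α β : res_axiom β (α ⊔ β)
| ra_meetl α β : res_axiom (α ⊓ β) α
| ra_meetr α β : res_axiom (α ⊓ β) β
| ra_meet_join α β γ : res_axiom (α ⊓ (β ⊔ γ)) ((α ⊓ β) ⊔ (α ⊓ γ))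
| ra_meet_join' α β γ : res_axiom ((α ⊓ β) ⊔ (α ⊓ γ)) (α ⊓ (β ⊔ γ))
| ra_join_meet α β γ : res_axiom (α ⊔ (β ⊓ γ)) ((α ⊔ β) ⊓ (α ⊔ γ))
| ra_join_meet' α β γ : res_axiom ((α ⊔ β) ⊓ (α ⊔ γ)) (α ⊔ (β ⊓ γ))
| ra_assoc α β γ : res_axiom (α · (β · γ)) ((α · β) · γ)
| ra_assoc' α β γ : res_axiom ((α · β) · γ) (α · (β · γ))
| ra_unitr α : res_axiom (α · 𝟙) α
| ra_unitr' α : res_axiom α (α · 𝟙)
| ra_unitl α : res_axiom (𝟙 · α) α
| ra_unitl' α : res_axiom α (𝟙 · α)
| ra_top α : res_axiom α 𝟙
| ra_bot α : res_axiom 𝟘 α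
| ra_dot_joinr α β γ : res_axiom (α · (β ⊔ γ)) ((α · β) ⊔ (α · γ))
| ra_dot_joinl α β γ : res_axiom ((β ⊔ γ) · α) ((β · α) ⊔ (γ · α)).

Inductive fm_axiom : fm AtProp AtRes -> Prop :=
| ax_K A B : fm_axiom (A → B → A)
| ax_S A B C : fm_axiom ((A → B → C) → (A → B) → A → C)
| ax_andl A B : fm_axiom (A ∧ B → A)
| ax_andr A B : fm_axiom (A ∧ B → B)
| ax_and A B : fm_axiom (A → B → A ∧ B)
| ax_orl A B : fm_axiom (A → A ∨ B)
| ax_orr A B : fm_axiom (B → A ∨ B)
| ax_or A B C : fm_axiom ((A → C) → (B → C) → A ∨ B → C)
| ax_bot A : fm_axiom (⊥ → A)
| ax_top : fm_axiom ⊤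
| ax_D1 A B : fm_axiom (◇ (A ∨ B) ↔ ◇ A ∨ ◇ B)
| ax_D2 : fm_axiom (◇ ⊥ ↔ ⊥)
| ax_D3 α β : fm_axiom (◇ᵣ (α ⊔ β) ↔ ◇ᵣ α ∨ ◇ᵣ β)
| ax_D4 : fm_axiom (◇ᵣ 𝟘 ↔ ⊥)
| ax_B1 α β A : fm_axiom ((α ⊔ β) ▷ A ↔ (α ▷ A) ∧ (β ▷ A))
| ax_B2 A : fm_axiom (𝟘 ▷ A)
| ax_B3 α β A : fm_axiom (α ▷ (β ▷ A) → (α · β) ▷ A)
| ax_B4 α β γ : fm_axiom ((α ⊔ β) ▷ᵣ γ ↔ (α ▷ᵣ γ) ∧ (β ▷ᵣ γ))
| ax_B5 α : fm_axiom (𝟘 ▷ᵣ α)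
| ax_B6 α β γ : fm_axiom (α ▷ᵣ (β ⊓ γ) ↔ (α ▷ᵣ β) ∧ (α ▷ᵣ γ))
| ax_B7 α : fm_axiom (α ▷ᵣ 𝟙)
| ax_BD1 α A : fm_axiom (◇ᵣ α ∧ (α ▷ A) → ◇ A)
| ax_BD2 α β : fm_axiom (α ▷ᵣ β → α ▷ ◇ᵣ β).

(* The rules of the Hilbert system read as rules on sequents: [hilbert_rule H  *)
(* s] has premises [H] and conclusion [s]. Theoremhood of [C] is read as       *)
(* [𝕀 ⊢ C], and [A ⊢ B] (theoremhood of [A → B]) as the sequent [A ⊢ B].       *)
(* Uniform substitution, which is not a schematic rule, is not listed.         *)
Inductive hilbert_rule : set (sequent AtProp AtRes) -> sequent AtProp AtRes -> Prop :=
| h_trans α β γ : hilbert_rule [set α ⊢ᵣ β; β ⊢ᵣ γ] (α ⊢ᵣ γ)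
| h_join α β γ : hilbert_rule [set α ⊢ᵣ γ; β ⊢ᵣ γ] (α ⊔ β ⊢ᵣ γ)
| h_meet α β γ : hilbert_rule [set γ ⊢ᵣ α; γ ⊢ᵣ β] (γ ⊢ᵣ α ⊓ β)
| h_MF α β γ : hilbert_rule [set α ⊢ᵣ β] (α · γ ⊢ᵣ β · γ)
| h_MF' α β γ : hilbert_rule [set α ⊢ᵣ β] (γ · α ⊢ᵣ γ · β)
| h_mp A B : hilbert_rule [set 𝕀 ⊢ A; 𝕀 ⊢ A → B] (𝕀 ⊢ B)
| h_MB α A B : hilbert_rule [set A ⊢ B] (α ▷ A ⊢ α ▷ B)
| h_MD A B : hilbert_rule [set A ⊢ B] (◇ A ⊢ ◇ B)
| h_AB α β A : hilbert_rule [set α ⊢ᵣ β] (β ▷ A ⊢ α ▷ A)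
| h_MD' α β : hilbert_rule [set α ⊢ᵣ β] (◇ᵣ α ⊢ ◇ᵣ β)
| h_MB' α β γ : hilbert_rule [set α ⊢ᵣ β] (γ ▷ᵣ α ⊢ γ ▷ᵣ β)
| h_AB' α β γ : hilbert_rule [set α ⊢ᵣ β] (β ▷ᵣ γ ⊢ α ▷ᵣ γ).

End Hilbert.

Section CutContexts.
Context (AtProp AtRes : Type).
Context (A : fm AtProp AtRes) (Z : fms AtProp AtRes).

(* [seq_repl s t]: t is obtained from the Fm-sequent s by replacing with Z one *)
(* occurrence of A as a substructure of s in succedent position; the other     *)
(* predicates do the same inside a structure.                                  *)
Inductive fma_repl : fma AtProp AtRes -> fma AtProp AtRes -> Prop :=
| ASemi_repl1 X X' Y : fma_repl X X' -> fma_repl (ASemi X Y) (ASemi X' Y)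
| ASemi_repl2 X Y Y' : fma_repl Y Y' -> fma_repl (ASemi X Y) (ASemi X Y')
| AGt_repl1 X X' Y : fms_repl X X' -> fma_repl (AGt X Y) (AGt X' Y)
| AGt_repl2 X Y Y' : fma_repl Y Y' -> fma_repl (AGt X Y) (AGt X Y')
| ALt_repl1 X X' Y : fma_repl X X' -> fma_repl (ALt X Y) (ALt X' Y)
| ALt_repl2 X Y Y' : fms_repl Y Y' -> fma_repl (ALt X Y) (ALt X Y')
| ACirc_repl X X' : fma_repl X X' -> fma_repl (ACirc X) (ACirc X')
| ACircR_repl Γ Γ' : resa_repl Γ Γ' -> fma_repl (ACircR Γ) (ACircR Γ')
with fms_repl : fms AtProp AtRes -> fms AtProp AtRes -> Prop :=
| SFm_repl : fms_repl A Z
| SSemi_repl1 X X' Y : fms_repl X X' -> fms_repl (SSemi X Y) (SSemi X' Y)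
| SSemi_repl2 X Y Y' : fms_repl Y Y' -> fms_repl (SSemi X Y) (SSemi X Y')
| SGt_repl1 X X' Y : fma_repl X X' -> fms_repl (SGt X Y) (SGt X' Y)
| SGt_repl2 X Y Y' : fms_repl Y Y' -> fms_repl (SGt X Y) (SGt X Y')
| SLt_repl1 X X' Y : fms_repl X X' -> fms_repl (SLt X Y) (SLt X' Y)
| SLt_repl2 X Y Y' : fma_repl Y Y' -> fms_repl (SLt X Y) (SLt X Y')
| SBul_repl X X' : fms_repl X X' -> fms_repl (SBul X) (SBul X')
| STri_repl1 Γ Γ' X : resa_repl Γ Γ' -> fms_repl (STri Γ X) (STri Γ' X)
| STri_repl2 Γ X X' : fms_repl X X' -> fms_repl (STri Γ X) (STri Γ X')
| STriR_repl1 Γ Γ' Δ : resa_repl Γ Γ' -> fms_repl (STriR Γ Δ) (STriR Γ' Δ)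
| STriR_repl2 Γ Δ Δ' : ress_repl Δ Δ' -> fms_repl (STriR Γ Δ) (STriR Γ Δ')
with resa_repl : resa AtProp AtRes -> resa AtProp AtRes -> Prop :=
| AOdot_repl1 Γ Γ' Δ : resa_repl Γ Γ' -> resa_repl (AOdot Γ Δ) (AOdot Γ' Δ)
| AOdot_repl2 Γ Δ Δ' : resa_repl Δ Δ' -> resa_repl (AOdot Γ Δ) (AOdot Γ Δ')
| AComma_repl1 Γ Γ' Δ : resa_repl Γ Γ' -> resa_repl (AComma Γ Δ) (AComma Γ' Δ)
| AComma_repl2 Γ Δ Δ' : resa_repl Δ Δ' -> resa_repl (AComma Γ Δ) (AComma Γ Δ')
| ASqsup_repl1 Γ Γ' Δ : ress_repl Γ Γ' -> resa_repl (ASqsup Γ Δ) (ASqsup Γ' Δ)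
| ASqsup_repl2 Γ Δ Δ' : resa_repl Δ Δ' -> resa_repl (ASqsup Γ Δ) (ASqsup Γ Δ')
| ASqsub_repl1 Γ Γ' Δ : resa_repl Γ Γ' -> resa_repl (ASqsub Γ Δ) (ASqsub Γ' Δ)
| ASqsub_repl2 Γ Δ Δ' : ress_repl Δ Δ' -> resa_repl (ASqsub Γ Δ) (ASqsub Γ Δ')
| ABTriUpR_repl1 Γ Γ' X :
    resa_repl Γ Γ' -> resa_repl (ABTriUpR Γ X) (ABTriUpR Γ' X)
| ABTriUpR_repl2 Γ X X' :
    fma_repl X X' -> resa_repl (ABTriUpR Γ X) (ABTriUpR Γ X')
with ress_repl : ress AtProp AtRes -> ress AtProp AtRes -> Prop :=
| SComma_repl1 Γ Γ' Δ : ress_repl Γ Γ' -> ress_repl (SComma Γ Δ) (SComma Γ' Δ)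
| SComma_repl2 Γ Δ Δ' : ress_repl Δ Δ' -> ress_repl (SComma Γ Δ) (SComma Γ Δ')
| SGtdot_repl1 Γ Γ' Δ : resa_repl Γ Γ' -> ress_repl (SGtdot Γ Δ) (SGtdot Γ' Δ)
| SGtdot_repl2 Γ Δ Δ' : ress_repl Δ Δ' -> ress_repl (SGtdot Γ Δ) (SGtdot Γ Δ')
| SLtdot_repl1 Γ Γ' Δ : ress_repl Γ Γ' -> ress_repl (SLtdot Γ Δ) (SLtdot Γ' Δ)
| SLtdot_repl2 Γ Δ Δ' : resa_repl Δ Δ' -> ress_repl (SLtdot Γ Δ) (SLtdot Γ Δ')
| SSqsup_repl1 Γ Γ' Δ : resa_repl Γ Γ' -> ress_repl (SSqsup Γ Δ) (SSqsup Γ' Δ)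
| SSqsup_repl2 Γ Δ Δ' : ress_repl Δ Δ' -> ress_repl (SSqsup Γ Δ) (SSqsup Γ Δ')
| SSqsub_repl1 Γ Γ' Δ : ress_repl Γ Γ' -> ress_repl (SSqsub Γ Δ) (SSqsub Γ' Δ)
| SSqsub_repl2 Γ Δ Δ' : resa_repl Δ Δ' -> ress_repl (SSqsub Γ Δ) (SSqsub Γ Δ')
| SBulR_repl X X' : fms_repl X X' -> ress_repl (SBulR X) (SBulR X')
| SBTri_repl1 X X' Y : fma_repl X X' -> ress_repl (SBTri X Y) (SBTri X' Y)
| SBTri_repl2 X Y Y' : fms_repl Y Y' -> ress_repl (SBTri X Y) (SBTri X Y')
| SBTriR_repl1 X X' Δ : fma_repl X X' -> ress_repl (SBTriR X Δ) (SBTriR X' Δ)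
| SBTriR_repl2 X Δ Δ' : ress_repl Δ Δ' -> ress_repl (SBTriR X Δ) (SBTriR X Δ').

Inductive seq_repl : sequent AtProp AtRes -> sequent AtProp AtRes -> Prop :=
| seq_repl1 X X' Y : fma_repl X X' -> seq_repl (X ⊢ Y) (X' ⊢ Y)
| seq_repl2 X Y Y' : fms_repl Y Y' -> seq_repl (X ⊢ Y) (X ⊢ Y').

End CutContexts.

Section DisplayCalculus.
Context (AtProp AtRes : Type).
Implicit Types (A B : fm AtProp AtRes) (α β : res AtRes).
Implicit Types (p : AtProp) (a : AtRes).
Local Notation sequent := (sequent AtProp AtRes).

Inductive axiom : sequent -> Prop :=
| id_fm p : axiom (FAtom p ⊢ FAtom p)
| id_res a : axiom (RAtom a ⊢ᵣ RAtom a)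
| bot_l : axiom (⊥ ⊢ 𝕀)
| top_r : axiom (𝕀 ⊢ ⊤)
| zero_l : axiom (𝟘 ⊢ᵣ Φ)
| one_r : axiom (Φ ⊢ᵣ 𝟙).

(* Premise, then conclusion, of the one-premise rules that are not invertible. *)
Inductive rule1 : sequent -> sequent -> Prop :=
| fm_exch_l X Y Z : rule1 (Y ;; X ⊢ Z) (X ;; Y ⊢ Z)
| fm_exch_r X Y Z : rule1 (Z ⊢ X ;; Y) (Z ⊢ Y ;; X)
| fm_weak_l X Y Z : rule1 (Y ⊢ Z) (X ;; Y ⊢ Z)
| fm_weak_r X Y Z : rule1 (Z ⊢ Y) (Z ⊢ Y ;; X)
| fm_contr_l X Y : rule1 (X ;; X ⊢ Y) (X ⊢ Y)
| fm_contr_r X Y : rule1 (Y ⊢ X ;; X) (Y ⊢ X)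
| res_weak_Phi Γ Δ : rule1 (Φ ⊢ᵣ Δ) (Γ ⊢ᵣ Δ)
| res_weak_l Γ Σ Δ : rule1 (Γ ⊢ᵣ Δ) (Γ ,, Σ ⊢ᵣ Δ)
| res_weak_r Γ Δ Σ : rule1 (Γ ⊢ᵣ Δ) (Γ ⊢ᵣ Δ ,, Σ)
| res_contr_l Γ Δ : rule1 (Γ ,, Γ ⊢ᵣ Δ) (Γ ⊢ᵣ Δ)
| res_contr_r Γ Δ : rule1 (Γ ⊢ᵣ Δ ,, Δ) (Γ ⊢ᵣ Δ)
| res_exch_l Γ Δ Σ : rule1 (Γ ,, Δ ⊢ᵣ Σ) (Δ ,, Γ ⊢ᵣ Σ)
| res_exch_r Γ Δ Σ : rule1 (Σ ⊢ᵣ Γ ,, Δ) (Σ ⊢ᵣ Δ ,, Γ)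
| res_distr Γ Δ Σ Π :
    rule1 (Π ⊢ᵣ (Γ ⋗ Δ) ,, (Γ ⋗ Σ)) (Π ⊢ᵣ Γ ⋗ (Δ ,, Σ))
| bul_semi X Y Z : rule1 (X ⊢ (• Y) ;; (• Z)) (X ⊢ • (Y ;; Z))
| bulR_semi Γ X Y : rule1 (Γ ⊢ᵣ (•ᵣ X) ,, (•ᵣ Y)) (Γ ⊢ᵣ •ᵣ (X ;; Y))
| bul_I X : rule1 (X ⊢ 𝕀) (X ⊢ • 𝕀)
| bulR_I Γ : rule1 (Γ ⊢ᵣ Φ) (Γ ⊢ᵣ •ᵣ 𝕀)
| btriR_semi Γ Y Z Δ :
    rule1 (Γ ⊢ᵣ (Y ^▶ᵣ Δ) ,, (Z ^▶ᵣ Δ)) (Γ ⊢ᵣ (Y ;; Z) ^▶ᵣ Δ)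
| btri_semi Γ Y Z W :
    rule1 (Γ ⊢ᵣ (Y ^▶ W) ,, (Z ^▶ W)) (Γ ⊢ᵣ (Y ;; Z) ^▶ W)
| btriupR_semi Γ X Y Δ :
    rule1 ((Γ ^▲ᵣ X) ,, (Γ ^▲ᵣ Y) ⊢ᵣ Δ) (Γ ^▲ᵣ (X ;; Y) ⊢ᵣ Δ)
| tri_odot X Γ Δ Y :
    rule1 (X ⊢ Γ ^▷ (Δ ^▷ Y)) (X ⊢ (Γ ⊙ Δ) ^▷ Y)
| btriupR_I Γ Δ : rule1 (Φ ⊢ᵣ Δ) (Γ ^▲ᵣ 𝕀 ⊢ᵣ Δ)
| bd1 X Γ Y : rule1 (X ⊢ Γ ^▷ (• Y)) (X ⊢ (∘ᵣ Γ) > Y)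
| bd2 X Γ Y : rule1 (X ⊢ Γ ^▷ᵣ (•ᵣ Y)) (X ⊢ Γ ^▷ Y)
| bot_r X : rule1 (X ⊢ 𝕀) (X ⊢ ⊥)
| top_l X : rule1 (𝕀 ⊢ X) (⊤ ⊢ X)
| and_l A B X : rule1 (A ;; B ⊢ X) (A ∧ B ⊢ X)
| or_r A B X : rule1 (X ⊢ A ;; B) (X ⊢ A ∨ B)
| imp_r A B X : rule1 (X ⊢ A > B) (X ⊢ A → B)
| zero_r Γ : rule1 (Γ ⊢ᵣ Φ) (Γ ⊢ᵣ 𝟘)
| one_l Γ : rule1 (Φ ⊢ᵣ Γ) (𝟙 ⊢ᵣ Γ)
| dot_l α β Γ : rule1 (α ⊙ β ⊢ᵣ Γ) (α · β ⊢ᵣ Γ)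
| join_r α β Γ : rule1 (Γ ⊢ᵣ α ,, β) (Γ ⊢ᵣ α ⊔ β)
| meet_l α β Γ : rule1 (α ,, β ⊢ᵣ Γ) (α ⊓ β ⊢ᵣ Γ)
| dia_l A X : rule1 (∘ A ⊢ X) (◇ A ⊢ X)
| dia_r A X : rule1 (X ⊢ A) (∘ X ⊢ ◇ A)
| tri_r α A X : rule1 (X ⊢ α ^▷ A) (X ⊢ α ▷ A)
| diaR_l α X : rule1 (∘ᵣ α ⊢ X) (◇ᵣ α ⊢ X)
| diaR_r α Γ : rule1 (Γ ⊢ᵣ α) (∘ᵣ Γ ⊢ ◇ᵣ α)
| triR_r α β X : rule1 (X ⊢ α ^▷ᵣ β) (X ⊢ α ▷ᵣ β).

Inductive rule_inv : sequent -> sequent -> Prop :=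
| disp_semi_l1 X Y Z : rule_inv (X ;; Y ⊢ Z) (Y ⊢ X > Z)
| disp_semi_r1 X Y Z : rule_inv (Z ⊢ X ;; Y) (X > Z ⊢ Y)
| disp_semi_l2 X Y Z : rule_inv (X ;; Y ⊢ Z) (X ⊢ Z < Y)
| disp_semi_r2 X Y Z : rule_inv (Z ⊢ X ;; Y) (Z < Y ⊢ X)
| disp_comma_l1 Γ Δ Σ : rule_inv (Γ ,, Δ ⊢ᵣ Σ) (Δ ⊢ᵣ Γ ⊐ Σ)
| disp_comma_l2 Γ Δ Σ : rule_inv (Γ ,, Δ ⊢ᵣ Σ) (Γ ⊢ᵣ Σ ⊏ Δ)
| disp_comma_r1 Γ Δ Σ : rule_inv (Γ ⊢ᵣ Δ ,, Σ) (Δ ⊐ Γ ⊢ᵣ Σ)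
| disp_comma_r2 Γ Δ Σ : rule_inv (Γ ⊢ᵣ Δ ,, Σ) (Γ ⊏ Σ ⊢ᵣ Δ)
| disp_odot1 Γ Δ Σ : rule_inv (Γ ⊙ Δ ⊢ᵣ Σ) (Δ ⊢ᵣ Γ ⋗ Σ)
| disp_odot2 Γ Δ Σ : rule_inv (Γ ⊙ Δ ⊢ᵣ Σ) (Γ ⊢ᵣ Σ ⋖ Δ)
| disp_circ X Y : rule_inv (∘ X ⊢ Y) (X ⊢ • Y)
| disp_circR Γ X : rule_inv (∘ᵣ Γ ⊢ X) (Γ ⊢ᵣ •ᵣ X)
| disp_tri X Γ Y : rule_inv (X ⊢ Γ ^▷ Y) (Γ ⊢ᵣ X ^▶ Y)
| disp_triR1 X Γ Δ : rule_inv (X ⊢ Γ ^▷ᵣ Δ) (Γ ^▲ᵣ X ⊢ᵣ Δ)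
| disp_triR2 X Γ Δ : rule_inv (X ⊢ Γ ^▷ᵣ Δ) (Γ ⊢ᵣ X ^▶ᵣ Δ)
| fm_unit_l X Y : rule_inv (X ⊢ Y) (𝕀 ;; X ⊢ Y)
| fm_unit_r X Y : rule_inv (Y ⊢ X) (Y ⊢ X ;; 𝕀)
| fm_assoc_l X Y Z W : rule_inv (X ;; (Y ;; Z) ⊢ W) ((X ;; Y) ;; Z ⊢ W)
| fm_assoc_r X Y Z W : rule_inv (W ⊢ (Z ;; Y) ;; X) (W ⊢ Z ;; (Y ;; X))
| res_unit_r Γ Δ : rule_inv (Γ ⊙ Φ ⊢ᵣ Δ) (Γ ⊢ᵣ Δ)
| res_unit_l Γ Δ : rule_inv (Γ ⊢ᵣ Δ) (Φ ⊙ Γ ⊢ᵣ Δ)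
| res_unit_s Γ Δ : rule_inv (Γ ⊢ᵣ Δ) (Γ ⊢ᵣ Δ ,, Φ)
| res_odot_assoc Γ Δ Σ Π :
    rule_inv (Γ ⊙ (Δ ⊙ Σ) ⊢ᵣ Π) ((Γ ⊙ Δ) ⊙ Σ ⊢ᵣ Π)
| res_assoc_l Γ Δ Σ Π :
    rule_inv (Σ ,, (Δ ,, Γ) ⊢ᵣ Π) ((Σ ,, Δ) ,, Γ ⊢ᵣ Π)
| res_assoc_r Γ Δ Σ Π :
    rule_inv (Π ⊢ᵣ Σ ,, (Δ ,, Γ)) (Π ⊢ᵣ (Σ ,, Δ) ,, Γ).

(* The two premises, then the conclusion, of the two-premise rules. *)
Inductive rule2 : sequent -> sequent -> sequent -> Prop :=
| cut_fm A Z s t : seq_repl A Z s t -> rule2 s (A ⊢ Z) t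
| cut_res Γ α Δ : rule2 (Γ ⊢ᵣ α) (α ⊢ᵣ Δ) (Γ ⊢ᵣ Δ)
| and_r A B X Y : rule2 (X ⊢ A) (Y ⊢ B) (X ;; Y ⊢ A ∧ B)
| or_l A B X Y : rule2 (A ⊢ X) (B ⊢ Y) (A ∨ B ⊢ X ;; Y)
| imp_l A B X Y : rule2 (X ⊢ A) (B ⊢ Y) (A → B ⊢ X > Y)
| dot_r α β Γ Δ : rule2 (Γ ⊢ᵣ α) (Δ ⊢ᵣ β) (Γ ⊙ Δ ⊢ᵣ α · β)
| join_l α β Γ Δ : rule2 (α ⊢ᵣ Γ) (β ⊢ᵣ Δ) (α ⊔ β ⊢ᵣ Γ ,, Δ)
| meet_r α β Γ Δ : rule2 (Γ ⊢ᵣ α) (Δ ⊢ᵣ β) (Γ ,, Δ ⊢ᵣ α ⊓ β)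
| tri_l α A Γ X : rule2 (Γ ⊢ᵣ α) (A ⊢ X) (α ▷ A ⊢ Γ ^▷ X)
| triR_l α β Γ Δ : rule2 (Γ ⊢ᵣ α) (β ⊢ᵣ Δ) (α ▷ᵣ β ⊢ Γ ^▷ᵣ Δ).

(* [derivable_from H s]: s has a derivation with open leaves in H. A rule with *)
(* premises H and conclusion s is derivable if [derivable_from H s].           *)
Inductive derivable_from (H : set sequent) : sequent -> Prop :=
| d_hyp s : H s -> derivable_from H s
| d_axiom s : axiom s -> derivable_from H s
| d_rule1 s t : rule1 s t -> derivable_from H s -> derivable_from H t
| d_inv_down s t : rule_inv s t -> derivable_from H s -> derivable_from H t
| d_inv_up s t : rule_inv s t -> derivable_from H t -> derivable_from H s
| d_rule2 s1 s2 t : rule2 s1 s2 t ->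
    derivable_from H s1 -> derivable_from H s2 -> derivable_from H t.

Definition derivable (s : sequent) : Prop := derivable_from set0 s.

End DisplayCalculus.

(* The lattice operations and bounds are those of the order library; in        *)
(* particular the unit of [fus] is the lattice top.                            *)
Record lrc_algebra := LrcAlgebra {
  fm_disp : Order.disp_t;
  res_disp : Order.disp_t;
  fm_alg : tbLatticeType fm_disp;
  res_alg : tbDistrLatticeType res_disp;
  himp : fm_alg -> fm_alg -> fm_alg;
  fus : res_alg -> res_alg -> res_alg;
  tri : res_alg -> fm_alg -> fm_alg;
  dia : fm_alg -> fm_alg;
  triR : res_alg -> res_alg -> fm_alg;
  diaR : res_alg -> fm_alg;
  himpP : forall u v w, (Order.meet u v <= w) = (u <= himp v w);
  fusA : associative fus;
  fus1q : left_id \top fus;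
  fusq1 : right_id \top fus;
  fusUl : forall α β γ,
    fus (Order.join α β) γ = Order.join (fus α γ) (fus β γ);
  fusUr : forall α β γ,
    fus α (Order.join β γ) = Order.join (fus α β) (fus α γ);
  fus0q : left_zero \bot fus;
  fusq0 : right_zero \bot fus;
  diaU : forall u v, dia (Order.join u v) = Order.join (dia u) (dia v);
  dia0 : dia \bot = \bot;
  diaRU : forall α β, diaR (Order.join α β) = Order.join (diaR α) (diaR β);
  diaR0 : diaR \bot = \bot;
  tri_le : forall α u v, u <= v -> tri α u <= tri α v;
  triU : forall α β u, tri (Order.join α β) u = Order.meet (tri α u) (tri β u);
  tri0 : forall u, tri \bot u = \top;
  triRU : forall α β γ,
    triR (Order.join α β) γ = Order.meet (triR α γ) (triR β γ);
  triR0 : forall γ, triR \bot γ = \top;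
  triRI : forall α β γ,
    triR α (Order.meet β γ) = Order.meet (triR α β) (triR α γ);
  triR1 : forall α, triR α \top = \top;
  tri_fus : forall α β u, tri α (tri β u) <= tri (fus α β) u;
  diaR_tri : forall α u, Order.meet (diaR α) (tri α u) <= dia u;
  triR_tri : forall α β, triR α β <= tri α (diaR β) }.

Definition complete_lattice d (L : porderType d) : Prop :=
  forall S : set L, (exists x, supremums S x) /\ (exists y, infimums S y).

(* inf_i sup_j x_ij = sup_f inf_i x_(i, f i), with f ranging over the choice   *)
(* functions.                                                                  *)
Definition completely_distributive d (L : porderType d) : Prop :=
  forall (I : Type) (J : I -> Type) (x : forall i, J i -> L)
    (s : I -> L) (m : (forall i, J i) -> L) (l r : L),
    (forall i, supremums (range (x i)) (s i)) -> infimums (range s) l ->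
    (forall f, infimums (range (fun i => x i (f i))) (m f)) ->
    supremums (range m) r -> l = r.

(* Taking S empty shows that the bottom element is not join-irreducible. *)
Definition completely_join_irreducible d (L : porderType d) (j : L) : Prop :=
  forall S : set L, supremums S j -> S j.

Definition join_generated d (L : porderType d) : Prop :=
  forall x : L, exists2 S : set L,
    S `<=` @completely_join_irreducible d L & supremums S x.

Definition perfect_lattice d (L : porderType d) : Prop :=
  [/\ complete_lattice L, completely_distributive L & join_generated L].

Definition preserves_joins d d' (L : porderType d) (M : porderType d')
    (f : L -> M) : Prop :=
  forall (S : set L) x, supremums S x -> supremums (f @` S) (f x).

Definition preserves_meets d d' (L : porderType d) (M : porderType d')
    (f : L -> M) : Prop :=
  forall (S : set L) x, infimums S x -> infimums (f @` S) (f x).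

Definition joins_to_meets d d' (L : porderType d) (M : porderType d')
    (f : L -> M) : Prop :=
  forall (S : set L) x, supremums S x -> infimums (f @` S) (f x).

Record perfect (F : lrc_algebra) : Prop := Perfect {
  perfect_fm : perfect_lattice (fm_alg F);
  perfect_res : perfect_lattice (res_alg F);
  perfect_fusl : forall β, preserves_joins (fun α => @fus F α β);
  perfect_fusr : forall α, preserves_joins (fun β => @fus F α β);
  perfect_dia : preserves_joins (@dia F);
  perfect_diaR : preserves_joins (@diaR F);
  perfect_tri : forall u, joins_to_meets (fun α => @tri F α u);
  perfect_triRl : forall β, joins_to_meets (fun α => @triR F α β);
  perfect_triRr : forall α, preserves_meets (fun β => @triR F α β) }.

Section Semantics.
Context (AtProp AtRes : Type) (F : lrc_algebra).
Context (vp : AtProp -> fm_alg F) (vr : AtRes -> res_alg F).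

Fixpoint res_val (α : res AtRes) : res_alg F :=
  match α with
  | RAtom a => vr a
  | ROne => \top
  | RZero => \bot
  | RDot α β => fus (res_val α) (res_val β)
  | RJoin α β => Order.join (res_val α) (res_val β)
  | RMeet α β => Order.meet (res_val α) (res_val β)
  end.

Fixpoint fm_val (A : fm AtProp AtRes) : fm_alg F :=
  match A with
  | FAtom p => vp p
  | FTop => \top
  | FBot => \bot
  | FOr A B => Order.join (fm_val A) (fm_val B)
  | FAnd A B => Order.meet (fm_val A) (fm_val B)
  | FImp A B => himp (fm_val A) (fm_val B)
  | FTri α A => tri (res_val α) (fm_val A)
  | FDia A => dia (fm_val A)
  | FDiaR α => diaR (res_val α)
  | FTriR α β => triR (res_val α) (res_val β)
  end.

End Semantics.

(* Main.v *)
Require Import Defs.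
From HB Require Import structures.
From mathcomp Require Import all_boot all_order.
From mathcomp Require Import boolp classical_sets.

(* Completeness is by a canonical model. Derivability makes formulas and       *)
(* resource terms into distributive pre-lattices; the upsets of their prime    *)
(* filters form two perfect lattices. On these, dot and the two diamonds are   *)
(* relational images, and ▷ᵣ is the universal modality of a ternary relation.  *)
(* Since ▷ is only monotone in its second coordinate, it is not relational and *)
(* is interpreted there by its π-extension. The inequalities linking ▷ to dot  *)
(* and to the diamonds survive by compactness, in the form of the prime filter *)
(* theorem, and a formula holds exactly at the prime filters containing it.    *)

Set Implicit Arguments.
Unset Strict Implicit.
Unset Printing Implicit Defensive.

Local Open Scope classical_set_scope.
Local Open Scope lrc_scope.

(** The syntactic half rests on display. An adjoint move isolates a join, meet or bound on one side
    of the turnstile, contraction or weakening disposes of it there, and the move is undone. This is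
    the usual proof that a residuated operation preserves joins; it gives distributivity in both
    sorts and the nontrivial halves of the axioms on joins, meets and bounds. The axioms B3, BD1 and
    BD2 come from the structural rules [tri_odot], [bd1] and [bd2]. The monotonicity rules of H.LRC
    follow from the logical rules, transitivity and modus ponens from cut.

    The semantic half refutes every underivable [A ⊢ B] in a single perfect algebra. Formulas and
    resource terms, preordered by derivability, are distributive pre-lattices; filters do not
    distinguish interderivable elements, so no quotient is taken. The canonical operations act
    pointwise on upsets of prime filters, so arbitrary unions and intersections pass through them
    directly. The work lies in the inequalities of an LRC-algebra and in the truth lemmas
    [can_res_val] and [can_fm_val]. Both call for prime filters standing in a prescribed relation,
    and [prime_filter_exists] supplies them: the axioms make the elements to be avoided an ideal,
    which is separated from the filter to be contained. A prime filter containing [A] but not [B]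
    then refutes the inequality between their values. *)

Ltac down c := eapply d_rule1; [eapply c|].
(* For a goal that is the lower (resp. upper) sequent of an invertible rule,   *)
(* [disp] (resp. [undisp]) leaves the other one.                               *)
Ltac disp c := eapply d_inv_down; [eapply c|].
Ltac undisp c := eapply d_inv_up; [eapply c|].
Ltac split2 c := eapply d_rule2; [eapply c| |].

(** * Derivations of the Hilbert axioms in D.LRC *)

Section Derivations.
Context (AtProp AtRes : Type) (H : set (sequent AtProp AtRes)).
Implicit Types (A B C : fm AtProp AtRes) (α β γ δ : res AtRes).
Implicit Types (X Y : fma AtProp AtRes) (Z W : fms AtProp AtRes).
Implicit Types (Γ Δ : resa AtProp AtRes) (Σ Π : ress AtProp AtRes).
Local Notation "⊩ s" := (derivable_from H s) (at level 85).

Lemma res_weak_l2 Γ Δ Σ : ⊩ Δ ⊢ᵣ Σ -> ⊩ Γ ,, Δ ⊢ᵣ Σ.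
Proof. by move=> h; down res_exch_l; down res_weak_l. Qed.

Lemma res_weak_r2 Γ Σ Π : ⊩ Γ ⊢ᵣ Π -> ⊩ Γ ⊢ᵣ Σ ,, Π.
Proof. by move=> h; down res_exch_r; down res_weak_r. Qed.

Lemma fm_weak_l1 X Y Z : ⊩ X ⊢ Z -> ⊩ X ;; Y ⊢ Z.
Proof. by move=> h; down fm_exch_l; down fm_weak_l. Qed.

Lemma fm_weak_r2 X Z W : ⊩ X ⊢ W -> ⊩ X ⊢ Z ;; W.
Proof. by move=> h; down fm_exch_r; down fm_weak_r. Qed.

Lemma fm_weak_I X Z : ⊩ 𝕀 ⊢ Z -> ⊩ X ⊢ Z.
Proof. by move=> h; undisp fm_unit_l; apply: fm_weak_l1. Qed.

Lemma fm_efq X Z : ⊩ X ⊢ 𝕀 -> ⊩ X ⊢ Z.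
Proof. by move=> h; undisp fm_unit_r; apply: fm_weak_r2. Qed.

Lemma res_efq Γ Σ : ⊩ Γ ⊢ᵣ Φ -> ⊩ Γ ⊢ᵣ Σ.
Proof. by move=> h; undisp res_unit_s; apply: res_weak_r2. Qed.

(** The instance of the deep cut rule in which the replaced occurrence is the whole succedent. *)
Lemma fm_cut X A Z : ⊩ X ⊢ A -> ⊩ A ⊢ Z -> ⊩ X ⊢ Z.
Proof.
move=> h1 h2; apply: (d_rule2 _ h1 h2).
by apply: cut_fm; apply: seq_repl2; apply: SFm_repl.
Qed.

Lemma res_cut Γ α Σ : ⊩ Γ ⊢ᵣ α -> ⊩ α ⊢ᵣ Σ -> ⊩ Γ ⊢ᵣ Σ.
Proof. by move=> h1 h2; split2 cut_res; [exact: h1 | exact: h2]. Qed.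

Lemma one_top Γ : ⊩ Γ ⊢ᵣ 𝟙.
Proof. by down res_weak_Phi; apply: d_axiom; apply: one_r. Qed.

Lemma zero_bot Σ : ⊩ 𝟘 ⊢ᵣ Σ.
Proof. by apply: res_efq; apply: d_axiom; apply: zero_l. Qed.

Lemma join_elim α β Σ : ⊩ α ⊢ᵣ Σ -> ⊩ β ⊢ᵣ Σ -> ⊩ α ⊔ β ⊢ᵣ Σ.
Proof. by move=> h1 h2; down res_contr_r; split2 join_l. Qed.

Lemma join_intro1 Γ α β : ⊩ Γ ⊢ᵣ α -> ⊩ Γ ⊢ᵣ α ⊔ β.
Proof. by move=> h; down join_r; down res_weak_r. Qed.

Lemma join_intro2 Γ α β : ⊩ Γ ⊢ᵣ β -> ⊩ Γ ⊢ᵣ α ⊔ β.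
Proof. by move=> h; down join_r; apply: res_weak_r2. Qed.

Lemma meet_intro Γ α β : ⊩ Γ ⊢ᵣ α -> ⊩ Γ ⊢ᵣ β -> ⊩ Γ ⊢ᵣ α ⊓ β.
Proof. by move=> h1 h2; down res_contr_l; split2 meet_r. Qed.

Lemma meet_elim1 α β Σ : ⊩ α ⊢ᵣ Σ -> ⊩ α ⊓ β ⊢ᵣ Σ.
Proof. by move=> h; down meet_l; down res_weak_l. Qed.

Lemma meet_elim2 α β Σ : ⊩ β ⊢ᵣ Σ -> ⊩ α ⊓ β ⊢ᵣ Σ.
Proof. by move=> h; down meet_l; apply: res_weak_l2. Qed.

Lemma fuse_mono α α' β β' :
  ⊩ α ⊢ᵣ α' -> ⊩ β ⊢ᵣ β' -> ⊩ α · β ⊢ᵣ α' · β'.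
Proof. by move=> h1 h2; down dot_l; split2 dot_r. Qed.

(** Identity is an axiom for atoms only; the right and left rules of each connective propagate
    it. *)
Lemma res_refl α : ⊩ α ⊢ᵣ α.
Proof.
elim: α => [a| | |α hα β hβ|α hα β hβ|α hα β hβ].
- by apply: d_axiom; apply: id_res.
- exact: one_top.
- exact: zero_bot.
- exact: fuse_mono.
- by apply: join_elim; [apply: join_intro1|apply: join_intro2].
- by apply: meet_intro; [apply: meet_elim1|apply: meet_elim2].
Qed.

(** The comma has the residual [⊐]: moving [α] across leaves the join alone in the antecedent, where
    it splits. The two lemmas on [·] below use the residuals of [⊙] in the same way. *)
Lemma meet_join_elim α β γ Σ :
  ⊩ α ⊓ β ⊢ᵣ Σ -> ⊩ α ⊓ γ ⊢ᵣ Σ -> ⊩ α ⊓ (β ⊔ γ) ⊢ᵣ Σ.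
Proof.
move=> h1 h2; down meet_l; undisp disp_comma_l1.
by apply: join_elim; disp disp_comma_l1;
  [apply: res_cut h1|apply: res_cut h2]; split2 meet_r; exact: res_refl.
Qed.

Lemma fuse_joinr_elim α β γ Σ :
  ⊩ α · β ⊢ᵣ Σ -> ⊩ α · γ ⊢ᵣ Σ -> ⊩ α · (β ⊔ γ) ⊢ᵣ Σ.
Proof.
move=> h1 h2; down dot_l; undisp disp_odot1.
by apply: join_elim; disp disp_odot1;
  [apply: res_cut h1|apply: res_cut h2]; split2 dot_r; exact: res_refl.
Qed.

Lemma fuse_joinl_elim α β γ Σ :
  ⊩ β · α ⊢ᵣ Σ -> ⊩ γ · α ⊢ᵣ Σ -> ⊩ (β ⊔ γ) · α ⊢ᵣ Σ.
Proof.
move=> h1 h2; down dot_l; undisp disp_odot2.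
by apply: join_elim; disp disp_odot2;
  [apply: res_cut h1|apply: res_cut h2]; split2 dot_r; exact: res_refl.
Qed.

Lemma res_axiom_derivable α β : res_axiom α β -> ⊩ α ⊢ᵣ β.
Proof.
case=> {α β}.
- exact: res_refl.
- by move=> α β; apply: join_intro1; apply: res_refl.
- by move=> α β; apply: join_intro2; apply: res_refl.
- by move=> α β; apply: meet_elim1; apply: res_refl.
- by move=> α β; apply: meet_elim2; apply: res_refl.
- by move=> α β γ; apply: meet_join_elim;
    [apply: join_intro1|apply: join_intro2]; apply: res_refl.
- move=> α β γ; apply: join_elim; apply: meet_intro.
  + by apply: meet_elim1; apply: res_refl.
  + by apply: meet_elim2; apply: join_intro1; apply: res_refl.
  + by apply: meet_elim1; apply: res_refl.
  + by apply: meet_elim2; apply: join_intro2; apply: res_refl.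
- move=> α β γ; apply: join_elim; apply: meet_intro.
  + by apply: join_intro1; apply: res_refl.
  + by apply: join_intro1; apply: res_refl.
  + by apply: meet_elim1; apply: join_intro2; apply: res_refl.
  + by apply: meet_elim2; apply: join_intro2; apply: res_refl.
- move=> α β γ; apply: meet_join_elim.
    by apply: meet_elim2; apply: join_intro1; apply: res_refl.
  (* Swapping the factors turns the remaining join to the right, so that the same distribution
     applies a second time. *)
  apply: (@res_cut _ (γ ⊓ (α ⊔ β))).
    apply: meet_intro; [apply: meet_elim2|apply: meet_elim1]; exact: res_refl.
  apply: meet_join_elim.
    by apply: meet_elim2; apply: join_intro1; apply: res_refl.
  apply: join_intro2; apply: meet_intro;
    [apply: meet_elim2|apply: meet_elim1]; exact: res_refl.
(* The left rule for [·] acts only on a whole antecedent, so the outer factor is displayed away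
   while the inner product is opened. *)
- move=> α β γ; down dot_l; undisp disp_odot1; down dot_l; disp disp_odot1.
  undisp res_odot_assoc; split2 dot_r; last exact: res_refl.
  by split2 dot_r; exact: res_refl.
- move=> α β γ; down dot_l; undisp disp_odot2; down dot_l; disp disp_odot2.
  disp res_odot_assoc; split2 dot_r; first exact: res_refl.
  by split2 dot_r; exact: res_refl.
- move=> α; down dot_l; undisp disp_odot1; down one_l; disp disp_odot1.
  by undisp res_unit_r; exact: res_refl.
- move=> α; disp res_unit_r; split2 dot_r; [exact: res_refl|exact: one_top].
- move=> α; down dot_l; undisp disp_odot2; down one_l; disp disp_odot2.
  by disp res_unit_l; exact: res_refl.
- move=> α; undisp res_unit_l; split2 dot_r; [exact: one_top|exact: res_refl].
- by move=> α; exact: one_top.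
- by move=> α; exact: zero_bot.
- move=> α β γ; apply: fuse_joinr_elim;
    by [apply: join_intro1; apply: res_refl|apply: join_intro2; apply: res_refl].
- move=> α β γ; apply: fuse_joinl_elim;
    by [apply: join_intro1; apply: res_refl|apply: join_intro2; apply: res_refl].
Qed.

Lemma top_intro X : ⊩ X ⊢ ⊤.
Proof. by apply: fm_weak_I; apply: d_axiom; apply: top_r. Qed.

Lemma bot_elim Z : ⊩ ⊥ ⊢ Z.
Proof. by apply: fm_efq; apply: d_axiom; apply: bot_l. Qed.

Lemma or_elim A B Z : ⊩ A ⊢ Z -> ⊩ B ⊢ Z -> ⊩ A ∨ B ⊢ Z.
Proof. by move=> h1 h2; down fm_contr_r; split2 or_l. Qed.

Lemma or_intro1 X A B : ⊩ X ⊢ A -> ⊩ X ⊢ A ∨ B.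
Proof. by move=> h; down or_r; down fm_weak_r. Qed.

Lemma or_intro2 X A B : ⊩ X ⊢ B -> ⊩ X ⊢ A ∨ B.
Proof. by move=> h; down or_r; apply: fm_weak_r2. Qed.

Lemma and_intro X A B : ⊩ X ⊢ A -> ⊩ X ⊢ B -> ⊩ X ⊢ A ∧ B.
Proof. by move=> h1 h2; down fm_contr_l; split2 and_r. Qed.

Lemma and_elim1 A B Z : ⊩ A ⊢ Z -> ⊩ A ∧ B ⊢ Z.
Proof. by move=> h; down and_l; apply: fm_weak_l1. Qed.

Lemma and_elim2 A B Z : ⊩ B ⊢ Z -> ⊩ A ∧ B ⊢ Z.
Proof. by move=> h; down and_l; down fm_weak_l. Qed.

Lemma dia_mono A B : ⊩ A ⊢ B -> ⊩ ◇ A ⊢ ◇ B.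
Proof. by move=> h; down dia_l; down dia_r. Qed.

Lemma diaR_mono α β : ⊩ α ⊢ᵣ β -> ⊩ ◇ᵣ α ⊢ ◇ᵣ β.
Proof. by move=> h; down diaR_l; down diaR_r. Qed.

Lemma tri_mono α β A B : ⊩ α ⊢ᵣ β -> ⊩ A ⊢ B -> ⊩ β ▷ A ⊢ α ▷ B.
Proof. by move=> h1 h2; down tri_r; split2 tri_l. Qed.

Lemma triR_mono α β γ δ : ⊩ α ⊢ᵣ β -> ⊩ γ ⊢ᵣ δ -> ⊩ β ▷ᵣ γ ⊢ α ▷ᵣ δ.
Proof. by move=> h1 h2; down triR_r; split2 triR_l. Qed.

Lemma imp_intro X A B : ⊩ A ;; X ⊢ B -> ⊩ X ⊢ A → B.
Proof. by move=> h; down imp_r; disp disp_semi_l1. Qed.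

Lemma fm_refl A : ⊩ A ⊢ A.
Proof.
elim: A => [p| | |A hA B hB|A hA B hB|A hA B hB|α A hA|A hA|α|α β].
- by apply: d_axiom; apply: id_fm.
- exact: top_intro.
- exact: bot_elim.
- by apply: or_elim; [apply: or_intro1|apply: or_intro2].
- by apply: and_intro; [apply: and_elim1|apply: and_elim2].
- by down imp_r; split2 imp_l.
- by apply: tri_mono => //; apply: res_refl.
- exact: dia_mono.
- by apply: diaR_mono; apply: res_refl.
- by apply: triR_mono; apply: res_refl.
Qed.

Lemma imp_uncurry X A B : ⊩ X ⊢ A → B -> ⊩ A ;; X ⊢ B.
Proof.
move=> h; undisp disp_semi_l1; apply: fm_cut h _.
by split2 imp_l; exact: fm_refl.
Qed.

Lemma and_curry A B C : ⊩ A ∧ B ⊢ C -> ⊩ A ⊢ B → C.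
Proof.
move=> h; apply: imp_intro; apply: fm_cut h.
by down fm_exch_l; split2 and_r; exact: fm_refl.
Qed.

Lemma and_uncurry A B C : ⊩ A ⊢ B → C -> ⊩ A ∧ B ⊢ C.
Proof. by move=> h; down and_l; down fm_exch_l; apply: imp_uncurry. Qed.

Lemma thm_imp A B : ⊩ A ⊢ B -> ⊩ 𝕀 ⊢ A → B.
Proof. by move=> h; apply: imp_intro; apply: fm_weak_l1. Qed.

Lemma fm_mp A B : ⊩ 𝕀 ⊢ A -> ⊩ 𝕀 ⊢ A → B -> ⊩ 𝕀 ⊢ B.
Proof.
move=> hA hAB; apply: (fm_cut hA); undisp fm_unit_l; down fm_exch_l.
exact: imp_uncurry.
Qed.

Lemma and_or_elim A B C Z :
  ⊩ A ∧ B ⊢ Z -> ⊩ A ∧ C ⊢ Z -> ⊩ A ∧ (B ∨ C) ⊢ Z.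
Proof.
move=> h1 h2; down and_l; undisp disp_semi_l1.
by apply: or_elim; disp disp_semi_l1;
  [apply: fm_cut h1|apply: fm_cut h2]; split2 and_r; exact: fm_refl.
Qed.

(** [∘] is left adjoint to [•], so a disjunction below it can be displayed and split. *)
Lemma dia_or A B : ⊩ ◇ (A ∨ B) ⊢ ◇ A ∨ ◇ B.
Proof.
down dia_l; undisp disp_circ; apply: or_elim; disp disp_circ.
- by apply: or_intro1; down dia_r; exact: fm_refl.
- by apply: or_intro2; down dia_r; exact: fm_refl.
Qed.

Lemma dia_bot : ⊩ ◇ ⊥ ⊢ ⊥.
Proof. by down dia_l; undisp disp_circ; apply: bot_elim. Qed.

Lemma diaR_join α β : ⊩ ◇ᵣ (α ⊔ β) ⊢ ◇ᵣ α ∨ ◇ᵣ β.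
Proof.
down diaR_l; undisp disp_circR; apply: join_elim; disp disp_circR.
- by apply: or_intro1; down diaR_r; exact: res_refl.
- by apply: or_intro2; down diaR_r; exact: res_refl.
Qed.

Lemma diaR_zero : ⊩ ◇ᵣ 𝟘 ⊢ ⊥.
Proof. by down diaR_l; undisp disp_circR; apply: zero_bot. Qed.

(** [disp_tri] is the Galois connection that makes [▷] antitone in its first coordinate: it displays
    the resource, whose join then splits. *)
Lemma tri_join α β A : ⊩ (α ▷ A) ∧ (β ▷ A) ⊢ (α ⊔ β) ▷ A.
Proof.
down tri_r; undisp disp_tri; apply: join_elim; disp disp_tri.
- by apply: and_elim1; split2 tri_l; [exact: res_refl|exact: fm_refl].
- by apply: and_elim2; split2 tri_l; [exact: res_refl|exact: fm_refl].
Qed.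

Lemma tri_zero X A : ⊩ X ⊢ 𝟘 ▷ A.
Proof. by down tri_r; undisp disp_tri; apply: zero_bot. Qed.

Lemma tri_dot α β A : ⊩ α ▷ (β ▷ A) ⊢ (α · β) ▷ A.
Proof.
down tri_r; undisp disp_tri; down dot_l; disp disp_tri; down tri_odot.
split2 tri_l; first exact: res_refl.
by split2 tri_l; [exact: res_refl|exact: fm_refl].
Qed.

Lemma triR_join α β γ : ⊩ (α ▷ᵣ γ) ∧ (β ▷ᵣ γ) ⊢ (α ⊔ β) ▷ᵣ γ.
Proof.
down triR_r; undisp disp_triR2; apply: join_elim; disp disp_triR2.
- by apply: and_elim1; split2 triR_l; exact: res_refl.
- by apply: and_elim2; split2 triR_l; exact: res_refl.
Qed.

Lemma triR_zero X α : ⊩ X ⊢ 𝟘 ▷ᵣ α.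
Proof. by down triR_r; undisp disp_triR2; apply: zero_bot. Qed.

Lemma triR_meet α β γ : ⊩ (α ▷ᵣ β) ∧ (α ▷ᵣ γ) ⊢ α ▷ᵣ (β ⊓ γ).
Proof.
down triR_r; undisp disp_triR1; apply: meet_intro; disp disp_triR1.
- by apply: and_elim1; split2 triR_l; exact: res_refl.
- by apply: and_elim2; split2 triR_l; exact: res_refl.
Qed.

Lemma triR_one X α : ⊩ X ⊢ α ▷ᵣ 𝟙.
Proof. by down triR_r; undisp disp_triR1; apply: one_top. Qed.

(** After residuation the goal is the conclusion of [bd1]. Its premise follows from monotonicity of
    [▷] and [A ⊢ • ◇ A], the unit of the adjunction between [∘] and [•]. The next lemma uses [bd2]
    and the unit for [∘ᵣ] likewise. *)
Lemma diaR_tri_dia α A : ⊩ ◇ᵣ α ∧ (α ▷ A) ⊢ ◇ A.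
Proof.
down and_l; undisp disp_semi_l2; down diaR_l; disp disp_semi_l2.
undisp disp_semi_l1; down bd1; split2 tri_l; first exact: res_refl.
by disp disp_circ; down dia_r; exact: fm_refl.
Qed.

Lemma triR_tri_diaR α β : ⊩ α ▷ᵣ β ⊢ α ▷ ◇ᵣ β.
Proof.
down tri_r; down bd2; split2 triR_l; first exact: res_refl.
by disp disp_circR; down diaR_r; exact: res_refl.
Qed.

Lemma thm_iff A B : ⊩ A ⊢ B -> ⊩ B ⊢ A -> ⊩ 𝕀 ⊢ A ↔ B.
Proof. by move=> h1 h2; apply: and_intro; apply: thm_imp. Qed.

Lemma fm_axiom_derivable C : fm_axiom C -> ⊩ 𝕀 ⊢ C.
Proof.
case=> {C}.
- by move=> A B; apply: thm_imp; apply: and_curry; apply: and_elim1; exact: fm_refl.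
- move=> A B C; apply: thm_imp; apply: and_curry; apply: and_curry.
  set D := _ ∧ A.
  have hA : ⊩ D ⊢ A by apply: and_elim2; exact: fm_refl.
  have hB : ⊩ D ⊢ B.
    apply: (@fm_cut _ ((A → B) ∧ A)).
      by apply: and_intro => //; apply: and_elim1; apply: and_elim2; exact: fm_refl.
    by apply: and_uncurry; exact: fm_refl.
  apply: (@fm_cut _ ((B → C) ∧ B)); last by apply: and_uncurry; exact: fm_refl.
  apply: and_intro => //; apply: (@fm_cut _ ((A → B → C) ∧ A)).
    by apply: and_intro => //; apply: and_elim1; apply: and_elim1; exact: fm_refl.
  by apply: and_uncurry; exact: fm_refl.
- by move=> A B; apply: thm_imp; apply: and_elim1; exact: fm_refl.
- by move=> A B; apply: thm_imp; apply: and_elim2; exact: fm_refl.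
- by move=> A B; apply: thm_imp; apply: and_curry; exact: fm_refl.
- by move=> A B; apply: thm_imp; apply: or_intro1; exact: fm_refl.
- by move=> A B; apply: thm_imp; apply: or_intro2; exact: fm_refl.
- move=> A B C; apply: thm_imp; apply: and_curry; apply: and_curry.
  apply: and_or_elim; apply: and_uncurry;
    by [apply: and_elim1; exact: fm_refl|apply: and_elim2; exact: fm_refl].
- by move=> A; apply: thm_imp; apply: bot_elim.
- exact: top_intro.
- move=> A B; apply: thm_iff; first exact: dia_or.
  apply: or_elim; apply: dia_mono;
    by [apply: or_intro1; exact: fm_refl|apply: or_intro2; exact: fm_refl].
- by apply: thm_iff; [exact: dia_bot|exact: bot_elim].
- move=> α β; apply: thm_iff; first exact: diaR_join.
  apply: or_elim; apply: diaR_mono;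
    by [apply: join_intro1; exact: res_refl|apply: join_intro2; exact: res_refl].
- by apply: thm_iff; [exact: diaR_zero|exact: bot_elim].
- move=> α β A; apply: thm_iff; last exact: tri_join.
  apply: and_intro; apply: tri_mono (fm_refl _);
    by [apply: join_intro1; exact: res_refl|apply: join_intro2; exact: res_refl].
- by move=> A; exact: tri_zero.
- by move=> α β A; apply: thm_imp; exact: tri_dot.
- move=> α β γ; apply: thm_iff; last exact: triR_join.
  apply: and_intro; apply: triR_mono (res_refl _);
    by [apply: join_intro1; exact: res_refl|apply: join_intro2; exact: res_refl].
- by move=> α; exact: triR_zero.
- move=> α β γ; apply: thm_iff; last exact: triR_meet.
  apply: and_intro; apply: triR_mono (res_refl _) _;
    by [apply: meet_elim1; exact: res_refl|apply: meet_elim2; exact: res_refl].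
- by move=> α; exact: triR_one.
- by move=> α A; apply: thm_imp; exact: diaR_tri_dia.
- by move=> α β; apply: thm_imp; exact: triR_tri_diaR.
Qed.

End Derivations.

(** * Hilbert rules and closure under uniform substitution *)

Section Closure.
Context (AtProp AtRes : Type).

Lemma hilbert_rule_derivable (H : set (sequent AtProp AtRes)) s :
  hilbert_rule H s -> derivable_from H s.
Proof.
have hyp2 (s1 s2 : sequent AtProp AtRes) :
    derivable_from [set s1; s2] s1 /\ derivable_from [set s1; s2] s2.
  by split; apply: d_hyp; [left|right].
have hyp1 (s1 : sequent AtProp AtRes) : derivable_from [set s1] s1.
  exact: d_hyp.
case=> {H s}.
- by move=> α β γ; have [] := hyp2 (α ⊢ᵣ β) (β ⊢ᵣ γ); apply: res_cut.
- by move=> α β γ; have [] := hyp2 (α ⊢ᵣ γ) (β ⊢ᵣ γ); apply: join_elim.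
- by move=> α β γ; have [] := hyp2 (γ ⊢ᵣ α) (γ ⊢ᵣ β); apply: meet_intro.
- by move=> α β γ; apply: fuse_mono => //; exact: res_refl.
- by move=> α β γ; apply: fuse_mono => //; exact: res_refl.
- by move=> A B; have [] := hyp2 (𝕀 ⊢ A) (𝕀 ⊢ A → B); apply: fm_mp.
- by move=> α A B; apply: tri_mono => //; exact: res_refl.
- by move=> A B; apply: dia_mono.
- by move=> α β A; apply: tri_mono => //; exact: fm_refl.
- by move=> α β; apply: diaR_mono.
- by move=> α β γ; apply: triR_mono => //; exact: res_refl.
- by move=> α β γ; apply: triR_mono => //; exact: res_refl.
Qed.

Context (σ : AtProp -> fm AtProp AtRes) (τ : AtRes -> res AtRes).

Lemma rule1_subst s t :
  rule1 s t -> rule1 (seq_subst σ τ s) (seq_subst σ τ t).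
Proof. by case=> *; constructor. Qed.

Lemma rule_inv_subst s t :
  rule_inv s t -> rule_inv (seq_subst σ τ s) (seq_subst σ τ t).
Proof. by case=> *; constructor. Qed.

Scheme fma_repl_min := Minimality for fma_repl Sort Prop
with fms_repl_min := Minimality for fms_repl Sort Prop
with resa_repl_min := Minimality for resa_repl Sort Prop
with ress_repl_min := Minimality for ress_repl Sort Prop.
Combined Scheme repl_min from
  fma_repl_min, fms_repl_min, resa_repl_min, ress_repl_min.

(** Cut acts at any depth, so substitution has to commute with replacement in a context; the four
    sorts of structure require a simultaneous induction. *)
Lemma seq_repl_subst A Z (s t : sequent AtProp AtRes) : seq_repl A Z s t ->
  seq_repl (fm_subst σ τ A) (fms_subst σ τ Z) (seq_subst σ τ s) (seq_subst σ τ t).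
Proof.
have [hfa [hfs _]] : 
    (forall X X', fma_repl A Z X X' ->
       fma_repl (fm_subst σ τ A) (fms_subst σ τ Z)
         (fma_subst σ τ X) (fma_subst σ τ X')) /\
    (forall X X', fms_repl A Z X X' ->
       fms_repl (fm_subst σ τ A) (fms_subst σ τ Z)
         (fms_subst σ τ X) (fms_subst σ τ X')) /\
    (forall Γ Γ', resa_repl A Z Γ Γ' ->
       resa_repl (fm_subst σ τ A) (fms_subst σ τ Z)
         (resa_subst σ τ Γ) (resa_subst σ τ Γ')) /\
    (forall Γ Γ', ress_repl A Z Γ Γ' ->
       ress_repl (fm_subst σ τ A) (fms_subst σ τ Z)
         (ress_subst σ τ Γ) (ress_subst σ τ Γ')).
  by apply: repl_min => *; constructor.
by case=> *; constructor; [apply: hfa|apply: hfs].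
Qed.

Lemma rule2_subst s1 s2 t : rule2 s1 s2 t ->
  rule2 (seq_subst σ τ s1) (seq_subst σ τ s2) (seq_subst σ τ t).
Proof.
case=> *; first by apply: cut_fm; apply: seq_repl_subst.
all: by constructor.
Qed.

(** All rules are schematic. Only the atomic identities stop being axioms after substitution, and
    they become general identities. *)
Lemma derivable_subst s : derivable s -> derivable (seq_subst σ τ s).
Proof.
elim=> {s} [//|s [p|a| | | |]|s t h _|s t h _|s t h _|s1 s2 t h _].
- exact: fm_refl.
- exact: res_refl.
- by apply: d_axiom; apply: bot_l.
- by apply: d_axiom; apply: top_r.
- by apply: d_axiom; apply: zero_l.
- by apply: d_axiom; apply: one_r.
- exact: (d_rule1 (rule1_subst h)).
- exact: (d_inv_down (rule_inv_subst h)).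
- exact: (d_inv_up (rule_inv_subst h)).
- by move=> h1 _ h2; apply: d_rule2 (rule2_subst h) h1 h2.
Qed.

End Closure.

(** * The perfect lattice of upsets of a preorder *)

Record upset T (R : T -> T -> Prop) := Upset {
  uset : T -> Prop;
  uset_up : forall x y, R x y -> uset x -> uset y }.
Coercion uset : upset >-> Funclass.

Section UpsetLattice.
Context (T : Type) (R : T -> T -> Prop).
Local Notation upset := (upset R).
Implicit Types (U V W : upset).

Lemma upset_eq U V : (forall x, U x <-> V x) -> U = V.
Proof.
case: U V => [u hu] [v hv] /= huv.
have euv : u = v by apply: funext => x; apply: propext.
by case: _ / euv hv {huv} => hv; congr Upset; apply: Prop_irrelevance.
Qed.

HB.instance Definition _ := gen_eqMixin upset.
HB.instance Definition _ := gen_choiceMixin upset.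

Definition upset_le U V := `[< forall x, U x -> V x >].

Lemma upset_le_refl : reflexive upset_le.
Proof. by move=> U; apply/asboolP. Qed.

Lemma upset_le_anti : antisymmetric upset_le.
Proof.
move=> U V /andP[/asboolP UV /asboolP VU].
by apply: upset_eq => x; split; [exact: UV|exact: VU].
Qed.

Lemma upset_le_trans : transitive upset_le.
Proof.
move=> V U W /asboolP UV /asboolP VW; apply/asboolP => x Ux.
exact/VW/UV.
Qed.

HB.instance Definition _ :=
  Order.Le_isPOrder.Build (Order.Disp tt tt) upset
    upset_le_refl upset_le_anti upset_le_trans.

Lemma upset_leP U V : reflect (forall x, U x -> V x) (U <= V)%O.
Proof. exact: asboolP. Qed.

Definition upset_meet U V : upset.
Proof.
exists (fun x => U x /\ V x) => x y xy.
by case=> Ux Vx; split; apply: uset_up xy _.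
Defined.

Definition upset_join U V : upset.
Proof.
exists (fun x => U x \/ V x) => x y xy.
by case=> ?; [left|right]; apply: uset_up xy _.
Defined.

Definition upset_bot : upset := Upset (fun x y _ (f : False) => f).
Definition upset_top : upset := Upset (fun x y _ (f : True) => f).

Lemma upset_meetP U V W : (U <= upset_meet V W)%O = (U <= V)%O && (U <= W)%O.
Proof.
apply/upset_leP/andP => [h|[/upset_leP h1 /upset_leP h2] x Ux].
  by split; apply/upset_leP => x /h [].
by split; [apply: h1|apply: h2].
Qed.

Lemma upset_joinP U V W : (upset_join U V <= W)%O = (U <= W)%O && (V <= W)%O.
Proof.
apply/upset_leP/andP => [h|[/upset_leP h1 /upset_leP h2] x [/h1|/h2] //].
by split; apply/upset_leP => x Ux; apply: h; [left|right].
Qed.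

HB.instance Definition _ :=
  Order.POrder_MeetJoin_isLattice.Build (Order.Disp tt tt) upset
    upset_meetP upset_joinP.

Lemma upset_meetUl : left_distributive (@Order.meet _ upset) (@Order.join _ upset).
Proof.
move=> U V W; apply: upset_eq => x /=; split => [[[Ux|Vx] Wx]|].
- by left.
- by right.
- by case=> -[Ux Wx]; split=> //; [left|right].
Qed.

HB.instance Definition _ :=
  Order.Lattice_Meet_isDistrLattice.Build (Order.Disp tt tt) upset upset_meetUl.

Lemma upset_le0x U : (upset_bot <= U)%O.
Proof. exact/upset_leP. Qed.

Lemma upset_lex1 U : (U <= upset_top)%O.
Proof. exact/upset_leP. Qed.

HB.instance Definition _ :=
  Order.hasBottom.Build (Order.Disp tt tt) upset upset_le0x.
HB.instance Definition _ :=
  Order.hasTop.Build (Order.Disp tt tt) upset upset_lex1.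

Definition upset_sup (S : set upset) : upset.
Proof.
exists (fun x => exists2 U, S U & uset U x) => x y xy.
by case=> U SU Ux; exists U => //; apply: uset_up xy _.
Defined.

Definition upset_inf (S : set upset) : upset.
Proof.
exists (fun x => forall U, S U -> uset U x) => x y xy.
by move=> h U SU; apply: uset_up xy _; apply: h.
Defined.

Lemma upset_supremumsP (S : set upset) U :
  supremums S U <-> forall x, U x <-> exists2 V, S V & uset V x.
Proof.
split=> [[hU lU] x|h].
  split=> [Ux|[V SV]]; last by apply/upset_leP: x; apply: hU.
  suff /upset_leP : (U <= upset_sup S)%O by apply.
  by apply: lU => V SV; apply/upset_leP => y Vy; exists V.
split=> [V SV|V hV]; apply/upset_leP => x; first by move=> Vx; apply/h; exists V.
by move=> /h[W /hV /upset_leP WV /WV].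
Qed.

Lemma upset_infimumsP (S : set upset) U :
  infimums S U <-> forall x, U x <-> forall V, S V -> uset V x.
Proof.
split=> [[hU lU] x|h].
  split=> [Ux V /hU /upset_leP/(_ _ Ux)//|].
  suff /upset_leP : (upset_inf S <= U)%O by apply.
  by apply: lU => V SV; apply/upset_leP => y; apply.
split=> [V SV|V hV]; apply/upset_leP => x; first by move=> /h; apply.
by move=> Vx; apply/h => W /hV /upset_leP; apply.
Qed.

Hypothesis Rrefl : forall x, R x x.
Hypothesis Rtrans : forall x y z, R x y -> R y z -> R x z.

Definition upset_principal (x : T) : upset :=
  Upset (uset := R x) (fun y z yz xy => Rtrans xy yz).

(** Joins are unions, so some member of the family contains [x] and, being an upset, everything
    above it. *)
Lemma upset_principal_irreducible x :
  completely_join_irreducible (upset_principal x).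
Proof.
move=> S /upset_supremumsP h.
have /h[V SV Vx] : upset_principal x x by apply: Rrefl.
suff -> : upset_principal x = V by [].
apply: upset_eq => y; split=> [xy|Vy]; first exact: uset_up xy Vx.
by apply/h; exists V.
Qed.

(** Suprema and infima are unions and intersections. Complete distributivity is thus the axiom of
    choice applied at each point, and every upset is the union of the principal upsets of its
    elements. *)
Lemma upset_perfect : perfect_lattice upset.
Proof.
split.
- move=> S; split; [exists (upset_sup S)|exists (upset_inf S)].
    by apply/upset_supremumsP => x; split.
  by apply/upset_infimumsP => x; split.
- move=> I J x s m l r hs /upset_infimumsP hl hm /upset_supremumsP hr.
  have {}hs i y : s i y <-> exists j, x i j y.
    have /upset_supremumsP -> := hs i.
    by split=> [[_ [j _ <-] ?]|[j ?]]; [exists j|exists (x i j) => //; exists j].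
  have {}hm f y : m f y <-> forall i, x i (f i) y.
    have /upset_infimumsP -> := hm f.
    by split=> [h i|h _ [i _ <-]] //; apply: h; exists i.
  apply: upset_eq => y; rewrite hl hr; split=> [h|].
    have {}h i : exists j, x i j y by apply/hs/h; exists i.
    exists (m (fun i => sval (cid (h i)))); first by eexists.
    by apply/hm => i; case: (cid (h i)).
  case=> _ [f _ <-] /hm h _ [i _ <-]; apply/hs; exists (f i); exact: h.
- move=> U; exists [set V | exists2 x, U x & V = upset_principal x].
    by move=> _ [x _ ->]; exact: upset_principal_irreducible.
  apply/upset_supremumsP => y; split=> [Uy|[_ [x Ux ->] /= xy]].
    by exists (upset_principal y); [exists y|exact: Rrefl].
  exact: uset_up xy Ux.
Qed.

(** The Kripke clause for intuitionistic implication. *)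
Definition upset_himp U V : upset :=
  Upset (uset := fun x => forall y, R x y -> U y -> V y)
    (fun x y xy h z yz => h z (Rtrans xy yz)).

Lemma upset_himpP U V W :
  (Order.meet U V <= W)%O = (U <= upset_himp V W)%O.
Proof.
apply/upset_leP/upset_leP => [h x Ux y xy Vy|h x [Ux Vx]].
  by apply: h; split=> //; apply: uset_up xy Ux.
exact: h Ux _ (Rrefl x) Vx.
Qed.

End UpsetLattice.

(** * Distributive pre-lattices and the prime filter theorem *)

Record predlat := PreDistrLattice {
  pd_car :> Type;
  ple : pd_car -> pd_car -> Prop;
  ptop : pd_car;
  pbot : pd_car;
  pmeet : pd_car -> pd_car -> pd_car;
  pjoin : pd_car -> pd_car -> pd_car;
  ple_refl : forall a, ple a a;
  ple_trans : forall a b c, ple a b -> ple b c -> ple a c;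
  ple_top : forall a, ple a ptop;
  pbot_le : forall a, ple pbot a;
  pmeet_glb : forall a b c, ple c a -> ple c b -> ple c (pmeet a b);
  pmeet_le1 : forall a b, ple (pmeet a b) a;
  pmeet_le2 : forall a b, ple (pmeet a b) b;
  pjoin_lub : forall a b c, ple a c -> ple b c -> ple (pjoin a b) c;
  ple_join1 : forall a b, ple a (pjoin a b);
  ple_join2 : forall a b, ple b (pjoin a b);
  pmeet_join : forall a b c,
    ple (pmeet a (pjoin b c)) (pjoin (pmeet a b) (pmeet a c)) }.

Section PrimeFilters.
Context (D : predlat).
Implicit Types (a b c : D) (F I : set D).

Record is_filter F : Prop := IsFilter {
  filter_top : F (ptop D);
  filter_up : forall a b, F a -> ple a b -> F b;
  filter_meet : forall a b, F a -> F b -> F (pmeet a b) }.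

Record is_ideal I : Prop := IsIdeal {
  ideal_bot : I (pbot D);
  ideal_down : forall a b, I b -> ple a b -> I a;
  ideal_join : forall a b, I a -> I b -> I (pjoin a b) }.

Record pfilter := PFilter {
  pset :> D -> Prop;
  pset_filter : is_filter pset;
  pset_bot : ~ pset (pbot D);
  pset_prime : forall a b, pset (pjoin a b) -> pset a \/ pset b }.

Definition pfilter_sub (x y : pfilter) := forall a, x a -> y a.

Lemma pfilter_subxx x : pfilter_sub x x.
Proof. by []. Qed.

Lemma pfilter_sub_trans x y z :
  pfilter_sub x y -> pfilter_sub y z -> pfilter_sub x z.
Proof. by move=> xy yz a /xy/yz. Qed.

Lemma principal_filter a : is_filter [set b | ple a b].
Proof.
split=> /=; first exact: ple_top.
  by move=> b c; apply: ple_trans.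
by move=> b c; apply: pmeet_glb.
Qed.

Lemma principal_ideal a : is_ideal [set b | ple b a].
Proof.
split=> /=; first exact: pbot_le.
  by move=> b c ca bc; apply: ple_trans bc ca.
by move=> b c; apply: pjoin_lub.
Qed.

Lemma pfilter_compl_ideal (x : pfilter) : is_ideal (~` pset x).
Proof.
split; first exact: pset_bot.
  by move=> a b nb ab xa; apply: nb; apply: filter_up (pset_filter x) _ _ xa ab.
by move=> a b na nb /pset_prime[].
Qed.

Lemma pmeet_mono a a' b b' : ple a a' -> ple b b' -> ple (pmeet a b) (pmeet a' b').
Proof.
by move=> ha hb; apply: pmeet_glb;
  [apply: ple_trans ha; apply: pmeet_le1|apply: ple_trans hb; apply: pmeet_le2].
Qed.

(** This set is the filter generated by [F] and [a]. It serves both the maximality argument below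
    and the implication case of the truth lemma. *)
Lemma filter_extend F a : is_filter F ->
  is_filter [set c | exists2 m, F m & ple (pmeet m a) c].
Proof.
move=> Ff; split=> /=.
- by exists (ptop D); [exact: filter_top|exact: ple_top].
- by move=> b c [m Fm mb] bc; exists m => //; apply: ple_trans bc.
- move=> b c [m Fm mb] [n Fn nc]; exists (pmeet m n); first exact: filter_meet.
  apply: pmeet_glb; [apply: ple_trans mb|apply: ple_trans nc];
    by apply: pmeet_mono; [apply: pmeet_le1 || apply: pmeet_le2|apply: ple_refl].
Qed.

(** By Zorn, take a maximal filter above [F] avoiding [I]. If it contained a join [a ∨ b] but
    neither disjunct, adding [a] or [b] would reach elements [c] and [d] of [I]; distributivity then
    puts [c ∨ d], an element of [I], into the filter. *)
Lemma prime_filter_exists F I : is_filter F -> is_ideal I ->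
  (forall a, F a -> I a -> False) ->
  exists2 x : pfilter, F `<=` pset x & forall a, x a -> I a -> False.
Proof.
move=> Ff Ii FI.
(* Stating the filter condition for the union of [F] and [G] makes the empty chain harmless: its
   union is empty, and [F] remains. *)
pose P := [set G | is_filter (F `|` G) /\ forall a, G a -> I a -> False].
have [|M [[Mf MI] Mmax]] := @Zorn_bigcup _ P.
  move=> C CP Ctot; split; last by move=> a [G /CP[_ GI]] /GI.
  split; first by left; exact: filter_top.
    move=> a b [Fa|[G CG Ga]] ab; first by left; apply: filter_up Fa ab.
    have [Gf _] := CP _ CG.
    by have [|Gb] := filter_up Gf (or_intror Ga) ab; [left|right; exists G].
  have in1 (G : set D) a b : C G -> (F `|` G) a -> (F `|` G) b ->
      (F `|` \bigcup_(G in C) G) (pmeet a b).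
    move=> CG ha hb; have [Gf _] := CP _ CG.
    by have [|Gab] := filter_meet Gf ha hb; [left|right; exists G].
  move=> a b [Fa|[G CG Ga]] [Fb|[G' CG' Gb]].
  - by left; apply: filter_meet.
  - by apply: in1 CG' _ _; [left|right].
  - by apply: in1 CG _ _; [right|left].
  - have [GG'|G'G] := Ctot _ _ CG CG'.
      by apply: in1 CG' _ _; right => //; apply: GG'.
    by apply: in1 CG _ _; right => //; apply: G'G.
have FMI a : (F `|` M) a -> I a -> False by case=> [/FI|/MI].
(* By maximality, the filter generated by the maximal one and a new element must meet [I]. *)
have ext a : ~ (F `|` M) a -> exists m c, [/\ (F `|` M) m, ple (pmeet m a) c & I c].
  move=> na; apply: contrapT => nI.
  pose Ma := [set c | exists2 m, (F `|` M) m & ple (pmeet m a) c].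
  have FMa : F `|` M `<=` Ma by move=> c FMc; exists c => //; apply: pmeet_le1.
  apply: (Mmax Ma).
    split=> [c Mc|MaM]; first by apply: FMa; right.
    apply: na; right; apply: MaM; exists (ptop D); first exact: filter_top.
    exact: pmeet_le2.
  split; last by move=> c [m Fm mac] Ic; apply: nI; exists m, c.
  suff -> : F `|` Ma = Ma by apply: filter_extend.
  by apply/seteqP; split=> c; [case=> // Fc; apply: FMa; left|right].
have FMbot : ~ (F `|` M) (pbot D) by move/FMI; apply; exact: ideal_bot.
have FMprime a b : (F `|` M) (pjoin a b) -> (F `|` M) a \/ (F `|` M) b.
  move=> hab; apply: contrapT => /not_orP[/ext[m [c [hm mac Ic]]]].
  move=> /ext[n [d [hn nbd Id]]].
  apply: (@FMI (pjoin c d)); last exact: ideal_join.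
  have hmn := filter_meet Mf (filter_meet Mf hm hn) hab.
  apply: (filter_up Mf hmn); apply: ple_trans (pmeet_join _ _ _) _.
  apply: pjoin_lub.
    apply: ple_trans (ple_join1 _ _); apply: ple_trans mac.
    by apply: pmeet_mono; [exact: pmeet_le1|exact: ple_refl].
  apply: ple_trans (ple_join2 _ _); apply: ple_trans nbd.
  by apply: pmeet_mono; [exact: pmeet_le2|exact: ple_refl].
by exists (PFilter Mf FMbot FMprime) => //= a; left.
Qed.

End PrimeFilters.

(** * The pre-lattices of formulas and of resource terms *)

Section CanonicalModel.
Context (AtProp AtRes : Type).
Local Notation fm := (fm AtProp AtRes).
Local Notation res := (res AtRes).
Implicit Types (A B C : fm) (α β γ δ : res).
Local Notation fm_le A B := (derivable (A ⊢ B)).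
Local Notation res_le α β := (@derivable AtProp AtRes (α ⊢ᵣ β)).

Lemma fm_meet_join A B C : fm_le (A ∧ (B ∨ C)) ((A ∧ B) ∨ (A ∧ C)).
Proof.
by apply: and_or_elim; [apply: or_intro1|apply: or_intro2]; exact: fm_refl.
Qed.

Definition fm_lat : predlat := PreDistrLattice
  (fun A => fm_refl set0 A) (fun A B C => @fm_cut _ _ set0 A B C)
  (fun A => top_intro set0 A) (fun A => bot_elim set0 A)
  (fun A B C => @and_intro _ _ set0 C A B)
  (fun A B => and_elim1 B (fm_refl set0 A))
  (fun A B => and_elim2 A (fm_refl set0 B))
  (fun A B C => @or_elim _ _ set0 A B C)
  (fun A B => or_intro1 B (fm_refl set0 A))
  (fun A B => or_intro2 A (fm_refl set0 B))
  fm_meet_join.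

Definition res_lat : predlat := PreDistrLattice
  (ple := fun α β => res_le α β)
  (fun α => res_refl set0 α) (fun α β γ => @res_cut _ _ set0 α β γ)
  (fun α => one_top set0 α) (fun α => zero_bot set0 α)
  (fun α β γ => @meet_intro _ _ set0 γ α β)
  (fun α β => meet_elim1 β (res_refl set0 α))
  (fun α β => meet_elim2 α (res_refl set0 β))
  (fun α β γ => @join_elim _ _ set0 α β γ)
  (fun α β => join_intro1 β (res_refl set0 α))
  (fun α β => join_intro2 α (res_refl set0 β))
  (fun α β γ => res_axiom_derivable set0 (ra_meet_join α β γ)).

Local Notation X := (pfilter fm_lat).
Local Notation Y := (pfilter res_lat).
Local Notation fm_up := (upset (@pfilter_sub fm_lat)).
Local Notation res_up := (upset (@pfilter_sub res_lat)).

Lemma fm_pf_up (x : X) A B : x A -> fm_le A B -> x B.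
Proof. exact: filter_up (pset_filter x) A B. Qed.

Lemma res_pf_up (y : Y) α β : y α -> res_le α β -> y β.
Proof. exact: filter_up (pset_filter y) α β. Qed.

Lemma fm_pf_and (x : X) A B : x A -> x B -> x (A ∧ B).
Proof. exact: filter_meet (pset_filter x) A B. Qed.

Lemma fm_pf_thm (x : X) A : fm_le ⊤ A -> x A.
Proof. by apply: fm_pf_up; apply: filter_top (pset_filter x). Qed.

Lemma fm_pf_or (x : X) A B : x (A ∨ B) -> x A \/ x B.
Proof. exact: pset_prime. Qed.

(** * Canonical relations and prime filters witnessing them *)

Lemma fuse_filter (u v : set res_lat) : is_filter u -> is_filter v ->
  is_filter (D := res_lat)
    [set γ | exists α β, [/\ u α, v β & res_le (α · β) γ]].
Proof.
move=> uf vf; split=> /=.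
- exists 𝟙, 𝟙; split; [exact: filter_top uf|exact: filter_top vf|].
  exact: one_top.
- by move=> γ δ [α [β [uα vβ h]]] γδ; exists α, β; split=> //; apply: res_cut γδ.
- move=> γ δ [α [β [uα vβ h]]] [α' [β' [uα' vβ' h']]].
  exists (α ⊓ α'), (β ⊓ β'); split; [exact: filter_meet uf _ _ uα uα'| |].
    exact: filter_meet vf _ _ vβ vβ'.
  apply: meet_intro; [apply: res_cut h|apply: res_cut h']; apply: fuse_mono;
    by [apply: meet_elim1; exact: res_refl|apply: meet_elim2; exact: res_refl].
Qed.

(** These are the elements that a filter [v] must avoid if [u · v] is to stay inside [z]. They form
    an ideal because [·] preserves joins, [z] is prime and [u] is closed under meets. *)
Lemma fuse_ideal_r (u : set res_lat) (z : Y) : is_filter u ->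
  is_ideal (D := res_lat) [set γ | exists2 α, u α & ~ z (α · γ)].
Proof.
move=> uf; split=> /=.
- exists 𝟙; first exact: filter_top uf.
  move=> /res_pf_up h; apply: (pset_bot (p := z)); apply: h.
  exact: res_axiom_derivable (ra_unitl _).
- move=> γ δ [α uα nz] γδ; exists α => // h; apply: nz; apply: res_pf_up h _.
  by apply: fuse_mono => //; exact: res_refl.
- move=> γ δ [α uα nz] [α' uα' nz']; exists (α ⊓ α').
    exact: filter_meet uf _ _ uα uα'.
  move=> h; have : z ((α ⊓ α') · γ ⊔ (α ⊓ α') · δ).
    by apply: res_pf_up h _; apply: res_axiom_derivable; apply: ra_dot_joinr.
  case/(pset_prime (p := z)) => {}h; [apply: nz|apply: nz'];
    apply: res_pf_up h _; apply: fuse_mono (res_refl _ _);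
    by [apply: meet_elim1; exact: res_refl|apply: meet_elim2; exact: res_refl].
Qed.

Lemma fuse_ideal_l (v : set res_lat) (z : Y) : is_filter v ->
  is_ideal (D := res_lat) [set γ | exists2 β, v β & ~ z (γ · β)].
Proof.
move=> vf; split=> /=.
- exists 𝟙; first exact: filter_top vf.
  move=> /res_pf_up h; apply: (pset_bot (p := z)); apply: h.
  exact: res_axiom_derivable (ra_unitr _).
- move=> γ δ [β vβ nz] γδ; exists β => // h; apply: nz; apply: res_pf_up h _.
  by apply: fuse_mono => //; exact: res_refl.
- move=> γ δ [β vβ nz] [β' vβ' nz']; exists (β ⊓ β').
    exact: filter_meet vf _ _ vβ vβ'.
  move=> h; have : z (γ · (β ⊓ β') ⊔ δ · (β ⊓ β')).
    by apply: res_pf_up h _; apply: res_axiom_derivable; apply: ra_dot_joinl.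
  case/(pset_prime (p := z)) => {}h; [apply: nz|apply: nz'];
    apply: res_pf_up h _; apply: fuse_mono (res_refl _ _) _;
    by [apply: meet_elim1; exact: res_refl|apply: meet_elim2; exact: res_refl].
Qed.

Definition fuse_sub (x y z : Y) := forall α β, x α -> y β -> z (α · β).
Definition dia_rel (x x' : X) := forall A, x' A -> x (◇ A).
Definition diaR_rel (x : X) (y : Y) := forall α, y α -> x (◇ᵣ α).
Definition triR_rel (x : X) (y z : Y) := forall α β, y α -> x (α ▷ᵣ β) -> z β.

Lemma fuse_sub_exists_r (u : Y) (F : set res_lat) (z : Y) : is_filter F ->
  (forall α β, u α -> F β -> z (α · β)) ->
  exists2 v : Y, F `<=` pset v & fuse_sub u v z.
Proof.
move=> Ff h.
have [β Fβ [α uα]|v Fv vI] := prime_filter_exists Ff (fuse_ideal_r z (pset_filter u)).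
  by apply; apply: h.
exists v => // α β uα vβ; apply: contrapT => nz.
by apply: (vI β vβ); exists α.
Qed.

Lemma fuse_sub_exists_l (v : Y) (F : set res_lat) (z : Y) : is_filter F ->
  (forall α β, F α -> v β -> z (α · β)) ->
  exists2 u : Y, F `<=` pset u & fuse_sub u v z.
Proof.
move=> Ff h.
have [α Fα [β vβ]|u Fu uI] := prime_filter_exists Ff (fuse_ideal_l z (pset_filter v)).
  by apply; apply: h.
exists u => // α β uα vβ; apply: contrapT => nz.
by apply: (uI α uα); exists β.
Qed.

(** The two factors are made prime one after the other: first [u] is found against the principal
    filter of [β], then that filter is enlarged to a prime [v] with [u] fixed. *)
Lemma fuse_sub_exists α β (z : Y) : z (α · β) ->
  exists u v : Y, [/\ u α, v β & fuse_sub u v z].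
Proof.
move=> zαβ.
have αf := principal_filter (D := res_lat) α.
have βf := principal_filter (D := res_lat) β.
have [α' /= αα' [β' /= ββ']|u αu uI] := prime_filter_exists αf (fuse_ideal_l z βf).
  by apply; apply: res_pf_up zαβ _; apply: fuse_mono.
have [β' β'v|v βv uv] := @fuse_sub_exists_r u _ z βf.
  by move=> uβ' ββ'; apply: contrapT => nz; apply: (uI β' uβ'); exists β'v.
exists u, v; split=> //; [apply: αu|apply: βv]; exact: res_refl.
Qed.

Lemma dia_compl_ideal (x : X) : is_ideal (D := fm_lat) [set A | ~ x (◇ A)].
Proof.
split=> /=.
- by move=> /fm_pf_up/(_ (dia_bot _)); exact: pset_bot.
- by move=> A B nB AB xA; apply: nB; apply: fm_pf_up xA _; apply: dia_mono.
- by move=> A B nA nB /fm_pf_up/(_ (dia_or _ _ _))/fm_pf_or[].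
Qed.

Lemma dia_rel_exists (x : X) (F : set fm_lat) : is_filter F ->
  (forall A, F A -> x (◇ A)) -> exists2 x' : X, F `<=` pset x' & dia_rel x x'.
Proof.
move=> Ff h.
have [A /h //|x' Fx' x'I] := prime_filter_exists Ff (dia_compl_ideal x).
by exists x' => // A x'A; apply: contrapT; apply: x'I.
Qed.

Lemma diaR_compl_ideal (x : X) : is_ideal (D := res_lat) [set α | ~ x (◇ᵣ α)].
Proof.
split=> /=.
- by move=> /fm_pf_up/(_ (diaR_zero _)); exact: pset_bot.
- by move=> α β nβ αβ xα; apply: nβ; apply: fm_pf_up xα _; apply: diaR_mono.
- by move=> α β nα nβ /fm_pf_up/(_ (diaR_join _ _ _))/fm_pf_or[].
Qed.

Lemma diaR_rel_exists (x : X) (F : set res_lat) : is_filter F ->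
  (forall α, F α -> x (◇ᵣ α)) -> exists2 y : Y, F `<=` pset y & diaR_rel x y.
Proof.
move=> Ff h.
have [α /h //|y Fy yI] := prime_filter_exists Ff (diaR_compl_ideal x).
by exists y => // α yα; apply: contrapT; apply: yI.
Qed.

Lemma triR_filter (x : X) (u : set res_lat) : is_filter u ->
  is_filter (D := res_lat) [set β | exists2 α, u α & x (α ▷ᵣ β)].
Proof.
move=> uf; split=> /=.
- by exists 𝟙; [exact: filter_top uf|apply: fm_pf_thm; apply: triR_one].
- move=> β γ [α uα xα] βγ; exists α => //; apply: fm_pf_up xα _.
  by apply: triR_mono => //; exact: res_refl.
- move=> β γ [α uα xα] [α' uα' xα']; exists (α ⊓ α').
    exact: filter_meet uf _ _ uα uα'.
  apply: fm_pf_up (triR_meet _ _ _ _); apply: fm_pf_and;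
    [apply: fm_pf_up xα _|apply: fm_pf_up xα' _]; apply: triR_mono (res_refl _ _);
    by [apply: meet_elim1; exact: res_refl|apply: meet_elim2; exact: res_refl].
Qed.

(** A filter [y] satisfies [triR_rel x y z] exactly when it avoids this ideal. *)
Lemma triR_ideal (x : X) (z : Y) :
  is_ideal (D := res_lat) [set α | exists2 β, ~ z β & x (α ▷ᵣ β)].
Proof.
have zi := pfilter_compl_ideal z.
split=> /=.
- by exists 𝟘; [exact: ideal_bot zi|apply: fm_pf_thm; apply: triR_zero].
- move=> α α' [β nβ xβ] αα'; exists β => //; apply: fm_pf_up xβ _.
  by apply: triR_mono => //; exact: res_refl.
- move=> α α' [β nβ xβ] [β' nβ' xβ']; exists (β ⊔ β').
    exact: ideal_join zi _ _ nβ nβ'.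
  apply: fm_pf_up (triR_join _ _ _ _); apply: fm_pf_and;
    [apply: fm_pf_up xβ _|apply: fm_pf_up xβ' _]; apply: triR_mono (res_refl _ _) _;
    by [apply: join_intro1; exact: res_refl|apply: join_intro2; exact: res_refl].
Qed.

(** First [z] is chosen to omit [β] and to contain all that [x] forces on the principal filter of
    [α]; then that principal filter is enlarged to a prime [y] avoiding [triR_ideal x z]. *)
Lemma triR_rel_exists (x : X) α β : ~ x (α ▷ᵣ β) ->
  exists y z : Y, [/\ triR_rel x y z, y α & ~ z β].
Proof.
move=> nx.
have Ff := triR_filter x (principal_filter (D := res_lat) α).
have [γ /= [α' αα' xγ] γβ|z Fz zI] :=
    prime_filter_exists Ff (principal_ideal (D := res_lat) β).
  by apply: nx; apply: fm_pf_up xγ _; apply: triR_mono.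
have [α' /= αα' [γ nγ xγ]|y αy yI] :=
    prime_filter_exists (principal_filter (D := res_lat) α) (triR_ideal x z).
  by apply: nγ; apply: Fz; exists α'.
exists y, z; split; last by move/zI; apply; exact: res_refl.
  by move=> α' γ yα' xγ; apply: contrapT => nγ; apply: (yI α' yα'); exists γ.
by apply: αy; exact: res_refl.
Qed.

(** * Operations and axioms of the canonical algebra *)

Definition can_fus (U V : res_up) : res_up.
Proof.
exists (fun z => exists x y, [/\ U x, V y & fuse_sub x y z]) => z z' zz'.
by move=> [x [y [Ux Vy h]]]; exists x, y; split=> // α β xα yβ; apply/zz'/h.
Defined.

Definition can_dia (U : fm_up) : fm_up.
Proof.
exists (fun x => exists2 x', U x' & dia_rel x x') => x y xy.
by move=> [x' Ux' h]; exists x' => // A x'A; apply/xy/h.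
Defined.

Definition can_diaR (U : res_up) : fm_up.
Proof.
exists (fun x => exists2 y, U y & diaR_rel x y) => x x' xx'.
by move=> [y Uy h]; exists y => // α yα; apply/xx'/h.
Defined.

Definition can_triR (U V : res_up) : fm_up.
Proof.
exists (fun x => forall y z, U y -> triR_rel x y z -> V z) => x x' xx' h y z Uy T.
by apply: h Uy _ => α β yα xαβ; apply: T yα _; apply: xx'.
Defined.

(* The π-extension in the second coordinate: V lies below the open upset of    *)
(* the ideal I when every element of V meets I. The σ-extension (filters        *)
(* instead of ideals) would break the proof of [can_tri_fus].                  *)
Definition can_tri (U : res_up) (V : fm_up) : fm_up.
Proof.
exists (fun x : X => forall (y : Y) (I : set fm_lat), U y -> is_ideal I ->
  (forall x' : X, V x' -> exists2 A, x' A & I A) ->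
  exists α A, [/\ y α, I A & x (α ▷ A)]) => x x' xx' h y I Uy Ii VI.
by have [α [A [yα IA xαA]]] := h y I Uy Ii VI; exists α, A; split=> //; apply: xx'.
Defined.

(** Rebracketing needs a prime filter for the new intermediate product. The filter generated by the
    products of two factors is compatible with the third by syntactic associativity, and enlarging
    it gives this prime filter. *)
Lemma can_fusA : associative can_fus.
Proof.
move=> U V W; apply: upset_eq => z; split.
  move=> [u [q [Uu [v [w [Vv Ww vwq]]] uqz]]].
  have Ff := fuse_filter (pset_filter u) (pset_filter v).
  have [|p Fp pwz] := @fuse_sub_exists_l w _ z Ff.
    move=> γ δ /= [α [β [uα vβ h]]] wδ.
    apply: res_pf_up (fuse_mono h (res_refl _ _)).
    by apply: res_pf_up (uqz _ _ uα (vwq _ _ vβ wδ)) _; apply: res_axiom_derivable;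
      apply: ra_assoc.
  exists p, w; split=> //; exists u, v; split=> // α β uα vβ; apply: Fp.
  by exists α, β; split=> //; exact: res_refl.
move=> [p [w [[u [v [Uu Vv uvp]]] Ww pwz]]].
have Ff := fuse_filter (pset_filter v) (pset_filter w).
have [|q Fq uqz] := @fuse_sub_exists_r u _ z Ff.
  move=> α γ uα /= [β [δ [vβ wδ h]]].
  apply: res_pf_up (fuse_mono (res_refl _ _) h).
  by apply: res_pf_up (pwz _ _ (uvp _ _ uα vβ) wδ) _; apply: res_axiom_derivable;
    apply: ra_assoc'.
exists u, q; split=> //; exists v, w; split=> // α β vα wβ; apply: Fq.
by exists α, β; split=> //; exact: res_refl.
Qed.

(** Since every filter contains [𝟙], multiplying by any [x] only enlarges a filter. Conversely, the
    principal filter of [𝟙] enlarges to a prime [x] with [x · z] inside [z]. *)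
Lemma can_fus1q : left_id \top%O can_fus.
Proof.
move=> U; apply: upset_eq => z; split=> [[x [y [_ Uy h]]]|Uz].
  apply: uset_up Uy => β yβ; apply: res_pf_up (h 𝟙 β _ yβ) _.
    exact: filter_top (pset_filter x).
  exact: res_axiom_derivable (ra_unitl _).
have [|x _ h] := @fuse_sub_exists_l z _ z (principal_filter (D := res_lat) 𝟙).
  move=> α β /= h zβ; apply: res_pf_up (fuse_mono h (res_refl _ _)).
  by apply: res_pf_up zβ _; apply: res_axiom_derivable; apply: ra_unitl'.
by exists x, z.
Qed.

Lemma can_fusq1 : right_id \top%O can_fus.
Proof.
move=> U; apply: upset_eq => z; split=> [[x [y [Ux _ h]]]|Uz].
  apply: uset_up Ux => α xα; apply: res_pf_up (h α 𝟙 xα _) _.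
    exact: filter_top (pset_filter y).
  exact: res_axiom_derivable (ra_unitr _).
have [|y _ h] := @fuse_sub_exists_r z _ z (principal_filter (D := res_lat) 𝟙).
  move=> α β zα /= h; apply: res_pf_up (fuse_mono (res_refl _ _) h).
  by apply: res_pf_up zα _; apply: res_axiom_derivable; apply: ra_unitr'.
by exists z, y.
Qed.

(** The ideal [J] generated by the formulas [β ▷ A], with [β] in [w] and [A] in [I], meets every
    point of [can_tri W V]. Testing the hypothesis on [y] and [J] gives [α ▷ (β ▷ A)] in [x], and B3
    with [α · β] in [z] concludes. *)
Lemma can_tri_fus (U W : res_up) (V : fm_up) :
  (can_tri U (can_tri W V) <= can_tri (can_fus U W) V)%O.
Proof.
apply/upset_leP => x h z I [y [w [Uy Ww ywz]]] Ii VI.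
have wf := pset_filter w.
pose J : set fm_lat := [set B | exists β A, [/\ w β, I A & fm_le B (β ▷ A)]].
have Ji : is_ideal J.
  split=> /=.
  - exists 𝟙, ⊥; split; [exact: filter_top wf|exact: ideal_bot Ii|].
    exact: bot_elim.
  - by move=> B C [β [A [wβ IA CA]]] BC; exists β, A; split=> //; apply: fm_cut CA.
  - move=> B C [β [A [wβ IA BA]]] [β' [A' [wβ' IA' CA']]].
    exists (β ⊓ β'), (A ∨ A'); split.
    + exact: filter_meet wf _ _ wβ wβ'.
    + exact: ideal_join Ii _ _ IA IA'.
    + apply: or_elim; [apply: fm_cut BA _|apply: fm_cut CA' _]; apply: tri_mono;
      by [apply: meet_elim1; exact: res_refl|apply: meet_elim2; exact: res_refl
         |apply: or_intro1; exact: fm_refl|apply: or_intro2; exact: fm_refl].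
have [|α [B [yα [β [A [wβ IA BA]]] xB]]] := h y J Uy Ji.
  move=> x' /(_ w I Ww Ii VI)[β [A [wβ IA x'A]]].
  by exists (β ▷ A) => //; exists β, A; split=> //; exact: fm_refl.
exists (α · β), A; split=> //; first exact: ywz.
apply: fm_pf_up xB _; apply: fm_cut (tri_dot _ _ _ _).
by apply: tri_mono => //; exact: res_refl.
Qed.

(** The test ideal consists of the [A] with [◇ A] not in [x]: if no point of [V] is related to [x],
    each of them meets it, and BD1 gives a contradiction. *)
Lemma can_diaR_tri (U : res_up) (V : fm_up) :
  (Order.meet (can_diaR U) (can_tri U V) <= can_dia V)%O.
Proof.
apply/upset_leP => x [[y Uy xy] h]; apply: contrapT => nV.
have [x' Vx'|α [A [yα nA xA]]] := h y _ Uy (dia_compl_ideal x).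
  apply: contrapT => x'I; apply: nV; exists x' => // A x'A.
  by apply: contrapT => nA; apply: x'I; exists A.
by apply: nA; apply: fm_pf_up (diaR_tri_dia _ _ _); apply: fm_pf_and xA; apply: xy.
Qed.

(** A compactness argument. Let [F] be what [x] forces on [y], and [G] the filter generated by the
    [◇ᵣ β] with [β] in [F]. If [G] missed [I], a prime [x'] above [G] avoiding [I] would be related
    to a prime [z] above [F]; such a [z] lies in [V], so [x'] would have to meet [I]. Hence [G]
    meets [I], and BD2 applies. *)
Lemma can_triR_tri (U V : res_up) :
  (can_triR U V <= can_tri U (can_diaR V))%O.
Proof.
apply/upset_leP => x h y I Uy Ii VI.
have Ff := triR_filter x (pset_filter y); set F := [set _ | _] in Ff.
pose G : set fm_lat := [set B | exists2 β, F β & fm_le (◇ᵣ β) B].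
have Gf : is_filter G.
  split=> /=.
  - by exists 𝟙; [exact: filter_top Ff|exact: top_intro].
  - by move=> A B [β Fβ βA] AB; exists β => //; apply: fm_cut AB.
  - move=> A B [β Fβ βA] [γ Fγ γB]; exists (β ⊓ γ).
      exact: filter_meet Ff _ _ Fβ Fγ.
    apply: and_intro; [apply: fm_cut βA|apply: fm_cut γB]; apply: diaR_mono;
    by [apply: meet_elim1; exact: res_refl|apply: meet_elim2; exact: res_refl].
apply: contrapT => nI.
have [B [β [α yα xβ] βB] IB|x' Gx' x'I] := prime_filter_exists Gf Ii.
  apply: nI; exists α, B; split=> //; apply: fm_pf_up xβ _.
  apply: fm_cut (triR_tri_diaR _ _ _) _.
  by apply: tri_mono => //; exact: res_refl.
have [|z Fz x'z] := @diaR_rel_exists x' F Ff.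
  by move=> β Fβ; apply: Gx'; exists β => //; exact: fm_refl.
have [|A x'A IA] := VI x'; last exact: x'I IA.
exists z => //; apply: h Uy _ => α β yα xβ; apply: Fz; by exists α.
Qed.

Definition canonical_algebra : lrc_algebra.
Proof.
apply: (@LrcAlgebra _ _ fm_up res_up
  (upset_himp (@pfilter_sub_trans _)) can_fus can_tri can_dia can_triR can_diaR).
- exact/upset_himpP/pfilter_subxx.
- exact: can_fusA.
- exact: can_fus1q.
- exact: can_fusq1.
- move=> U V W; apply: upset_eq => z; split.
    by move=> [x [y [[Ux|Vx] Wy h]]]; [left|right]; exists x, y.
  by move=> [[x [y [Ux Wy h]]]|[x [y [Ux Wy h]]]]; exists x, y;
    split=> //; [left|right].
- move=> U V W; apply: upset_eq => z; split.
    by move=> [x [y [Ux [Vy|Wy] h]]]; [left|right]; exists x, y.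
  by move=> [[x [y [Ux Wy h]]]|[x [y [Ux Wy h]]]]; exists x, y;
    split=> //; [left|right].
- by move=> U; apply: upset_eq => z; split=> // -[x [y []]].
- by move=> U; apply: upset_eq => z; split=> // -[x [y []]].
- move=> U V; apply: upset_eq => x; split.
    by move=> [x' [Ux'|Vx'] h]; [left|right]; exists x'.
  by move=> [[x' Ux' h]|[x' Ux' h]]; exists x' => //; [left|right].
- by apply: upset_eq => x; split=> // -[x' []].
- move=> U V; apply: upset_eq => x; split.
    by move=> [x' [Ux'|Vx'] h]; [left|right]; exists x'.
  by move=> [[x' Ux' h]|[x' Ux' h]]; exists x' => //; [left|right].
- by apply: upset_eq => x; split=> // -[x' []].
- move=> U V W /upset_leP VW; apply/upset_leP => x h y I Uy Ii WI.
  by apply: h => // x' /VW; apply: WI.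
- move=> U V W; apply: upset_eq => x; split=> [h|[hU hV] y I].
    by split=> y I ?; apply: h; [left|right].
  by case=> [/hU|/hV]; apply.
- by move=> W; apply: upset_eq => x; split=> // _ y I [].
- move=> U V W; apply: upset_eq => x; split=> [h|[hU hV] y z].
    by split=> y z ?; apply: h; [left|right].
  by case=> [/hU|/hV]; apply.
- by move=> W; apply: upset_eq => x; split=> // _ y z [].
- move=> U V W; apply: upset_eq => x; split=> [h|[hV hW] y z Uy T].
    by split=> y z Uy T; case: (h y z Uy T).
  by split; [apply: hV T|apply: hW T].
- by move=> U; apply: upset_eq => x.
- by move=> U W V; exact: can_tri_fus.
- exact: can_diaR_tri.
- exact: can_triR_tri.
Defined.

(** Each operation quantifies over the points of the argument concerned: existentially where unions
    are preserved, universally where they become intersections. For [can_tri] this holds in the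
    first coordinate; for [can_triR], intersections in the second coordinate pass through its
    conclusion. *)
Lemma canonical_perfect : perfect canonical_algebra.
Proof.
split.
- exact: upset_perfect (@pfilter_subxx _) (@pfilter_sub_trans _).
- exact: upset_perfect (@pfilter_subxx _) (@pfilter_sub_trans _).
- move=> V S U /upset_supremumsP hU; apply/upset_supremumsP => z; split.
    move=> [x [y [/hU[W SW Wx] Vy h]]].
    by exists (can_fus W V); [exists W|exists x, y].
  by move=> [_ [W SW <-] [x [y [Wx Vy h]]]]; exists x, y; split=> //; apply/hU; exists W.
- move=> V S U /upset_supremumsP hU; apply/upset_supremumsP => z; split.
    move=> [x [y [Vx /hU[W SW Wy] h]]].
    by exists (can_fus V W); [exists W|exists x, y].
  by move=> [_ [W SW <-] [x [y [Vx Wy h]]]]; exists x, y; split=> //; apply/hU; exists W.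
- move=> S U /upset_supremumsP hU; apply/upset_supremumsP => x; split.
    by move=> [x' /hU[W SW Wx'] h]; exists (can_dia W); [exists W|exists x'].
  by move=> [_ [W SW <-] [x' Wx' h]]; exists x' => //; apply/hU; exists W.
- move=> S U /upset_supremumsP hU; apply/upset_supremumsP => x; split.
    by move=> [x' /hU[W SW Wx'] h]; exists (can_diaR W); [exists W|exists x'].
  by move=> [_ [W SW <-] [x' Wx' h]]; exists x' => //; apply/hU; exists W.
- move=> V S U /upset_supremumsP hU; apply/upset_infimumsP => x; split.
    by move=> h _ [W SW <-] y I Wy; apply: h; apply/hU; exists W.
  move=> h y I /hU[W SW Wy]; apply: (h (can_tri W V)) Wy; by exists W.
- move=> V S U /upset_supremumsP hU; apply/upset_infimumsP => x; split.
    by move=> h _ [W SW <-] y z Wy; apply: h; apply/hU; exists W.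
  move=> h y z /hU[W SW Wy]; apply: (h (can_triR W V)) Wy; by exists W.
- move=> V S U /upset_infimumsP hU; apply/upset_infimumsP => x; split.
    by move=> h _ [W SW <-] y z Vy T; have /hU := h y z Vy T; apply.
  move=> h y z Vy T; apply/hU => W SW; apply: (h (can_triR V W)) Vy T; by exists W.
Qed.

(** * Truth lemma and completeness *)

Definition can_vp (p : AtProp) : fm_alg canonical_algebra :=
  Upset (R := @pfilter_sub fm_lat) (uset := fun x : X => x (FAtom p))
    (fun x y xy => xy (FAtom p)).

Definition can_vr (a : AtRes) : res_alg canonical_algebra :=
  Upset (R := @pfilter_sub res_lat) (uset := fun y : Y => y (RAtom a))
    (fun x y xy => xy (RAtom a)).

Lemma can_res_val α (y : Y) : uset (res_val can_vr α) y <-> y α.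
Proof.
elim: α y => [a| | |α hα β hβ|α hα β hβ|α hα β hβ] y //=.
- by split=> // _; exact: filter_top (pset_filter y).
- by split=> //; exact: pset_bot.
- split=> [[u [v [/hα uα /hβ vβ]]]|]; first exact.
  by move=> /fuse_sub_exists[u [v [/hα uα /hβ vβ h]]]; exists u, v.
- split=> [[/hα|/hβ] h|/(pset_prime (p := y))[/hα|/hβ]]; last 2 first.
  + by left.
  + by right.
  + exact: filter_up (pset_filter y) _ _ h (ple_join1 (p := res_lat) _ _).
  + exact: filter_up (pset_filter y) _ _ h (ple_join2 (p := res_lat) _ _).
- split=> [[/hα yα /hβ yβ]|h]; first exact: filter_meet (pset_filter y) _ _ yα yβ.
  split; [apply/hα|apply/hβ]; apply: res_pf_up h _;
    [exact: (pmeet_le1 (p := res_lat))|exact: (pmeet_le2 (p := res_lat))].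
Qed.

Lemma can_fm_val A (x : X) : uset (fm_val can_vp can_vr A) x <-> x A.
Proof.
elim: A x => [p| | |A hA B hB|A hA B hB|A hA B hB|α A hA|A hA|α|α β] x //=.
- by split=> // _; exact: filter_top (pset_filter x).
- by split=> //; exact: pset_bot.
- split=> [[/hA|/hB] h|/fm_pf_or[/hA|/hB]]; last 2 first.
  + by left.
  + by right.
  + by apply: fm_pf_up h _; apply: or_intro1; exact: fm_refl.
  + by apply: fm_pf_up h _; apply: or_intro2; exact: fm_refl.
- split=> [[/hA xA /hB xB]|h]; first exact: fm_pf_and.
  split; [apply/hA|apply/hB]; apply: fm_pf_up h _;
    [exact: (pmeet_le1 (p := fm_lat))|exact: (pmeet_le2 (p := fm_lat))].
- split=> [h|xAB x' xx' /hA x'A]; last first.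
    apply/hB; apply: fm_pf_up (fm_pf_and (xx' _ xAB) x'A) _.
    by apply: and_uncurry; exact: fm_refl.
  apply: contrapT => nAB.
  (* A counterexample is a prime extension of [x] that contains [A] and omits [B]. *)
  have Ff := filter_extend (D := fm_lat) A (pset_filter x).
  have [C /= [m xm mAC] CB|x' Fx' x'I] :=
      prime_filter_exists Ff (principal_ideal (D := fm_lat) B).
    apply: nAB; apply: fm_pf_up xm _; apply: and_curry; exact: fm_cut mAC CB.
  have x'm m : x m -> x' m.
    by move=> xm; apply: Fx'; exists m => //; apply: (pmeet_le1 (p := fm_lat)).
  apply: (x'I B); last exact: fm_refl.
  apply/hB; apply: h x'm _; apply/hA; apply: Fx'; exists ⊤.
    exact: filter_top (pset_filter x).
  exact: (pmeet_le2 (p := fm_lat)).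
- split=> [h|xA y I /can_res_val yα Ii AI]; last first.
    (* An ideal met by every prime filter containing [A] contains [A] itself, by separation; so [A]
       is its own witness. *)
    exists α, A; split=> //; apply: contrapT => nI.
    have [B /= AB IB|x' Ax' x'I] :=
        prime_filter_exists (principal_filter (D := fm_lat) A) Ii.
      by apply: nI; apply: ideal_down Ii _ _ IB AB.
    have /hA/AI[B x'B IB] : x' A by apply: Ax'; exact: fm_refl.
    exact: x'I IB.
  apply: contrapT => nA.
  (* By B1 and B2 the resources [β] with [β ▷ A] in [x] form an ideal. A prime [y] containing [α]
     and avoiding it, tested with the principal ideal of [A], yields [β] in [y] and [B] below [A]
     with [β ▷ B] in [x], contradicting the choice of [y]. *)
  have Ji : is_ideal (D := res_lat) [set β | x (β ▷ A)].
    split=> /=; first by apply: fm_pf_thm; apply: tri_zero.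
      move=> β γ xγ βγ; apply: fm_pf_up xγ _; apply: tri_mono => //; exact: fm_refl.
    by move=> β γ xβ xγ; apply: fm_pf_up (fm_pf_and xβ xγ) (tri_join _ _ _ _).
  have [β /= αβ xβ|y αy yJ] :=
      prime_filter_exists (principal_filter (D := res_lat) α) Ji.
    by apply: nA; apply: fm_pf_up xβ _; apply: tri_mono => //; exact: fm_refl.
  have [|x' /hA x'A|β [B [yβ BA xβ]]] :=
      h y _ _ (principal_ideal (D := fm_lat) A).
  + by apply/can_res_val; apply: αy; exact: res_refl.
  + by exists A => //; exact: fm_refl.
  + apply: (yJ β yβ); apply: fm_pf_up xβ _; apply: tri_mono => //; exact: res_refl.
- split=> [[x' /hA x'A]|xA]; first by apply.
  have [|x' Ax' xx'] := dia_rel_exists (x := x) (principal_filter (D := fm_lat) A).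
    by move=> B /= AB; apply: fm_pf_up xA _; apply: dia_mono.
  by exists x' => //; apply/hA; apply: Ax'; exact: fm_refl.
- split=> [[y /can_res_val yα]|xα]; first by apply.
  have [|y αy xy] := diaR_rel_exists (x := x) (principal_filter (D := res_lat) α).
    by move=> β /= αβ; apply: fm_pf_up xα _; apply: diaR_mono.
  by exists y => //; apply/can_res_val; apply: αy; exact: res_refl.
- split=> [h|xαβ y z /can_res_val yα T]; last by apply/can_res_val; apply: T xαβ.
  apply: contrapT => /triR_rel_exists[y [z [T yα zβ]]]; apply: zβ.
  by apply/can_res_val; apply: h T; apply/can_res_val.
Qed.

Lemma perfect_complete A B :
  (forall F : lrc_algebra, perfect F ->
     forall (vp : AtProp -> fm_alg F) (vr : AtRes -> res_alg F),
     (fm_val vp vr A <= fm_val vp vr B)%O) ->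
  fm_le A B.
Proof.
move=> /(_ _ canonical_perfect can_vp can_vr)/upset_leP AB.
apply: contrapT => nAB.
have [C /= AC CB|x Ax xB] := prime_filter_exists
  (principal_filter (D := fm_lat) A) (principal_ideal (D := fm_lat) B).
  by apply: nAB; apply: fm_cut CB.
have /can_fm_val/AB/can_fm_val : x A by apply: Ax; exact: fm_refl.
by move/xB; apply; exact: fm_refl.
Qed.

End CanonicalModel.

Theorem mainTheorem5 (AtProp AtRes : countType) :
  (forall α β : res AtRes, res_axiom α β ->
     @derivable AtProp AtRes (α ⊢ᵣ β)) /\
  (forall C : fm AtProp AtRes, fm_axiom C -> derivable (𝕀 ⊢ C)) /\
  (forall (H : set (sequent AtProp AtRes)) (s : sequent AtProp AtRes),
     hilbert_rule H s -> derivable_from H s) /\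
  (forall (σ : AtProp -> fm AtProp AtRes) (τ : AtRes -> res AtRes)
     (s : sequent AtProp AtRes),
     derivable s -> derivable (seq_subst σ τ s)) /\
  (forall A B : fm AtProp AtRes,
     (forall F : lrc_algebra, perfect F ->
        forall (vp : AtProp -> fm_alg F) (vr : AtRes -> res_alg F),
        (fm_val vp vr A <= fm_val vp vr B)%O) ->
     derivable (A ⊢ B)).
Proof.
split; first by move=> α β; exact: res_axiom_derivable.
split; first by move=> C; exact: fm_axiom_derivable.
split; first exact: hilbert_rule_derivable.
split; first exact: derivable_subst.
exact: perfect_complete.
Qed.
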